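(* Let $n,r,m\in\mathbb{N}$ with $r\le n$, let $\beta>0$, and let $\mathbf{A}:\mathcal{Z}^{(n-r)m}\to\mathcal{O}$ be any $(\varepsilon',\delta')$-item-level DP algorithm. Assume that $\varepsilon',\delta'$ and $\varepsilon' r\sqrt{m\log(n/(\beta\delta'))}$ are positive and sufficiently small. Then, for any distribution $\mathcal{D}$ over $\mathcal{Z}$, \[ \Pr_{\mathbf{x}\sim\mathcal{D}^{nm}}[\mathbf{A}\text{ is }(r,\varepsilon,\delta)\text{-local-deletion DP at }\mathbf{x}]\ge1-\beta, \] where $\varepsilon=O(\varepsilon' r\sqrt{m\log(n/(\beta\delta'))})$ and $\delta=O(rm\delta')$.
   Context: $\mathcal{O}$ is a finite output set. An input $\mathbf{x}\in\mathcal{Z}^{nm}$ consists of $n$ users' data $\mathbf{x}_1,\dots,\mathbf{x}_n\in\mathcal{Z}^m$; for $S\subseteq[n]$, $\mathbf{x}_{-S}$ denotes the input (in $\mathcal{Z}^{(n-|S|)m}$) with the data of all users in $S$ removed. An algorithm on $k$ samples is $(\varepsilon,\delta)$-item-level DP if for all inputs differing in one coordinate and all $S\subseteq\mathcal{O}$, $\Pr[\mathbf{A}(\mathbf{x})\in S]\le e^\varepsilon\Pr[\mathbf{A}(\mathbf{x}')\in S]+\delta$. For distributions $A,B$, $H_{e^\varepsilon}(A\|B)=\sum_o[A(o)-e^\varepsilon B(o)]_+$, and $A\approx_{\varepsilon,\delta}B$ means $H_{e^\varepsilon}(A\|B)\le\delta$ and $H_{e^\varepsilon}(B\|A)\le\delta$.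 $\mathbf{A}$ is $(r,\varepsilon,\delta)$-local-deletion DP at $\mathbf{x}$ if $\mathbf{A}(\mathbf{x}_{-S})\approx_{\varepsilon,\delta}\mathbf{A}(\mathbf{x}_{-S'})$ for all $S,S'\subseteq[n]$ with $|S|=|S'|=r$. ''Sufficiently small'' means at most some implicit absolute constant.
   Formalization: With remaining users listed in increasing order the claim fails for order-sensitive A, so it is proved for any A when x_{-S} keeps surviving users in their slots (vacated slots filled by the last r users), and in increasing order only for A invariant under permuting users; A is measurable. *)

(* Defs.v *)
From HB Require Import structures.
From mathcomp Require Import all_boot all_order all_fingroup all_algebra.
From mathcomp Require Import all_classical all_reals all_analysis.

Set Implicit Arguments.
Unset Strict Implicit.
Unset Printing Implicit Defensive.

Import Order.TTheory GRing.Theory Num.Theory.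
Import numFieldNormedType.Exports.

Local Open Scope ring_scope.

Section product_distribution.
Context (R : realType) (d : measure_display) (T : measurableType d).
Variable D : probability T R.

Definition consp (k : nat) (p : T * k.-tuple T) : k.+1.-tuple T :=
  [tuple of p.1 :: p.2].

Lemma measurable_consp (k : nat) :
  measurable_fun [set: T * k.-tuple T]%classic (@consp k).
Proof. exact: measurable_cons. Qed.

HB.instance Definition _ (k : nat) :=
  isMeasurableFun.Build _ _ _ _ (@consp k) (@measurable_consp k).

(* The product distribution D^k, characterized by [iid_rectangle]. *)
Fixpoint iid (k : nat) : probability (k.-tuple T) R :=
  match k with
  | 0 => \d_ [tuple]
  | k'.+1 => distribution (D \x iid k')%E (@consp k')
  end.

Lemma iid_rectangle (k : nat) (B : 'I_k -> set T) :
  (forall i, measurable (B i)) ->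
  iid k [set x | forall i, B i (tnth x i)]%classic = (\prod_(i < k) D (B i))%E.
Proof.
elim: k B => [|k IH] B mB /=.
  by rewrite big_ord0 /= /dirac /= indicE mem_set //=; case.
rewrite big_ord_recl -IH; last by move=> i; exact: mB.
rewrite /distribution /pushforward -product_measure1E //.
- congr (_ _); apply/seteqP; split=> [[t x] /= H|[t x] /= [H0 H] i].
    split; first by have := H ord0; rewrite tnth0.
    by move=> i; have := H (lift ord0 i); rewrite tnthS.
  by case: (unliftP ord0 i) => [j|] ->; rewrite ?tnthS ?tnth0.
- rewrite (_ : [set x | _]%classic = (\bigcap_(i in [set: 'I_k])
      ((fun x : k.-tuple T => tnth x i) @^-1` B (lift ord0 i)))%classic).
    apply: fin_bigcap_measurable => // i _; rewrite -[X in measurable X]setTI.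
    exact: measurable_tnth.
  by apply/seteqP; split=> x /= H i; [move=> _|]; exact: H.
Qed.

End product_distribution.

(* A randomized algorithm with finite output set O, given by its output
   probabilities; measurability in the input makes events about A(x), for a
   random x, measurable. *)
Record mechanism (R : realType) (d : measure_display) (T : measurableType d)
    (O : finType) := Mechanism {
  outprob :> T -> O -> R;
  outprob_ge0 : forall x o, 0 <= outprob x o;
  outprob_sum1 : forall x, \sum_o outprob x o = 1;
  measurable_outprob :
    forall o, measurable_fun [set: T]%classic (fun x => outprob x o)
}.

(* Inputs in Z^(k m) are tuples of k users' data, each in Z^m. *)

Definition differ_in_one_item (Z : Type) (k m : nat)
    (x x' : k.-tuple (m.-tuple Z)) : Prop :=
  exists (i : 'I_k) (j : 'I_m), forall (i' : 'I_k) (j' : 'I_m),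
    (i', j') <> (i, j) -> tnth (tnth x i') j' = tnth (tnth x' i') j'.

Definition item_level_dp (R : realType) (d : measure_display)
    (Z : measurableType d) (O : finType) (k m : nat)
    (A : mechanism R (k.-tuple (m.-tuple Z)) O) (eps delta : R) : Prop :=
  forall x x' : k.-tuple (m.-tuple Z), differ_in_one_item x x' ->
  forall S : {set O},
    \sum_(o in S) A x o <= expR eps * \sum_(o in S) A x' o + delta.

Definition hockey_stick (R : realType) (O : finType) (eps : R)
    (P Q : O -> R) : R :=
  \sum_o Num.max (P o - expR eps * Q o) 0.

Definition indist (R : realType) (O : finType) (eps delta : R)
    (P Q : O -> R) : Prop :=
  hockey_stick eps P Q <= delta /\ hockey_stick eps Q P <= delta.

(* x_{-S} is an ordered tuple, so it depends on the order in which the users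
   outside S are listed: [L S k] is the user placed in slot k. *)
Definition listing (n r : nat) : Type := {set 'I_n} -> 'I_(n - r) -> 'I_n.

Definition lists_survivors (n r : nat) (L : listing n r) : Prop :=
  forall S : {set 'I_n}, #|S| = r ->
    injective (L S) /\ forall k, L S k \notin S.

Definition remove_users (Z : Type) (n r m : nat) (L : listing n r)
    (x : n.-tuple (m.-tuple Z)) (S : {set 'I_n}) :
    (n - r).-tuple (m.-tuple Z) :=
  [tuple tnth x (L S k) | k < n - r].

Definition local_deletion_dp (R : realType) (d : measure_display)
    (Z : measurableType d) (O : finType) (n r m : nat) (L : listing n r)
    (A : mechanism R ((n - r).-tuple (m.-tuple Z)) O) (eps delta : R)
    (x : n.-tuple (m.-tuple Z)) : Prop :=
  forall S S' : {set 'I_n}, #|S| = r -> #|S'| = r ->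
    indist eps delta (A (remove_users L x S)) (A (remove_users L x S')).

Definition user_symmetric (R : realType) (d : measure_display)
    (Z : measurableType d) (O : finType) (k m : nat)
    (A : mechanism R (k.-tuple (m.-tuple Z)) O) : Prop :=
  forall (s : 'S_k) (x : k.-tuple (m.-tuple Z)) (o : O),
    A [tuple tnth x (s i) | i < k] o = A x o.

Section listings.
Context (n r : nat).

Let low (k : 'I_(n - r)) : 'I_n := widen_ord (leq_subr r n) k.

Definition increasing_listing : listing n r :=
  fun S k => nth (low k) (enum (~: S)) k.

Lemma increasing_listingP : lists_survivors increasing_listing.
Proof.
move=> S cS; have sz : size (enum (~: S)) = (n - r)%N.
  by rewrite -cardE cardsCs finset.setCK card_ord cS.
split=> [k k'|k].
  rewrite /increasing_listing (set_nth_default (low k)) ?sz //.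
  move/eqP; rewrite nth_uniq ?sz ?enum_uniq // => /eqP; exact: val_inj.
have : increasing_listing S k \in enum (~: S) by rewrite mem_nth ?sz.
by rewrite mem_enum inE.
Qed.

(* For a [user_symmetric] A, local-deletion DP does not depend on the listing.
   For other algorithms it does: item-level DP compares inputs slot by slot,
   but with the increasing listing the survivors common to x_{-S} and x_{-S'}
   may all sit in different slots, and e.g. the noisy alternating sum of the
   data then distinguishes x_{-S} from x_{-S'} even for r = 1. So the listing
   for general A has to put common survivors in the same slots, up to O(r)
   of them: here, the survivors among the first n - r users keep their own
   slots and those among the last r users fill the vacated ones. *)
Definition in_place_listing : listing n r :=
  fun S k => if low k \notin S then low k else
    nth (low k) (enum [set i : 'I_n | (n - r <= i)%N & i \notin S])
        (index k (enum [set l : 'I_(n - r) | low l \in S])).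

Let low_inj : injective low.
Proof. by move=> k k' /(congr1 val) /= /val_inj. Qed.

Lemma in_place_listing_stable (S S' : {set 'I_n}) : #|S| = r -> #|S'| = r ->
  (#|[pred k | in_place_listing S k != in_place_listing S' k]| <= 2 * r)%N.
Proof.
move=> cS cS'.
pose V := [set l | low l \in S] :|: [set l | low l \in S'].
have sub : [pred k | in_place_listing S k != in_place_listing S' k] \subset V.
  apply/fintype.subsetP => k; rewrite !inE /in_place_listing; apply: contraR.
  by rewrite negb_or => /andP[-> ->].
have card_low (U : {set 'I_n}) : (#|[set l | low l \in U]| <= #|U|)%N.
  rewrite -(card_imset _ low_inj); apply: subset_leq_card.
  by apply/fintype.subsetP => i /imsetP[l]; rewrite inE => lU ->.
apply: (leq_trans (subset_leq_card sub)).
rewrite (leq_trans (leq_card_setU _ _)) // mul2n -addnn leq_add //.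
  by rewrite (leq_trans (card_low S)) ?cS.
by rewrite (leq_trans (card_low S')) ?cS'.
Qed.

Lemma in_place_listingP : lists_survivors in_place_listing.
Proof.
move=> S cS.
set hi := [set i : 'I_n | (n - r <= i)%N & i \notin S].
set vac := [set l : 'I_(n - r) | low l \in S].
have card_hi : #|hi| = #|vac|.
  have E1 : #|~: S| = (n - r)%N by rewrite cardsCs finset.setCK card_ord cS.
  have E2 : ~: S = hi :|: low @: (~: vac).
    apply/setP => i; rewrite !inE; case: (leqP (n - r) i) => [hi_i|lo_i] /=.
      case iS: (i \in S) => //=; symmetry; apply/negP => /imsetP[l _ il].
      by move: hi_i; rewrite il /= leqNgt ltn_ord.
    have -> : i = low (Ordinal lo_i) by apply: val_inj.
    by rewrite mem_imset // !inE.
  have E3 : hi :&: low @: (~: vac) = finset.set0.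
    apply/setP => i; rewrite !inE; apply/negP => /andP[/andP[hi_i _]].
    by case/imsetP => l _ il; move: hi_i; rewrite il /= leqNgt ltn_ord.
  move: (cardsUI hi (low @: (~: vac))); rewrite -E2 E3 cards0 addn0 E1.
  rewrite card_imset // => E4; apply: (@addIn #|~: vac|).
  by rewrite -E4 cardsC card_ord.
have in_hi k : low k \in S -> (index k (enum vac) < size (enum hi))%N.
  move=> kS; rewrite -(cardE hi) card_hi cardE index_mem mem_enum inE.
  exact: kS.
have out k : low k \in S -> in_place_listing S k \in hi.
  move=> kS; rewrite /in_place_listing kS /= -/hi -/vac -mem_enum.
  by rewrite mem_nth ?in_hi.
have outN k : low k \notin S -> in_place_listing S k \notin hi.
  by move=> kS; rewrite /in_place_listing kS inE /= leqNgt ltn_ord.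
split=> [k k' E|k]; last first.
  have [kS|kS] := boolP (low k \in S); last by rewrite /in_place_listing kS.
  by have := out _ kS; rewrite inE => /andP[].
have [kS|kS] := boolP (low k \in S); have [kS'|kS'] := boolP (low k' \in S).
- move: E; rewrite /in_place_listing kS kS' /= -/hi -/vac.
  rewrite (set_nth_default (low k')) ?in_hi // => /eqP.
  rewrite nth_uniq ?in_hi ?enum_uniq // => /eqP E.
  have kv : k \in enum vac by rewrite mem_enum inE.
  have kv' : k' \in enum vac by rewrite mem_enum inE.
  by rewrite -(nth_index k kv) -(nth_index k kv') E.
- by have := out _ kS; rewrite E (negbTE (outN _ kS')).
- by have := out _ kS'; rewrite -E (negbTE (outN _ kS)).
- by apply: low_inj; move: E; rewrite /in_place_listing kS kS'.
Qed.

End listings.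

(* Main.v *)
(* Fix two sets of deleted users. The corresponding inputs agree except in at
   most 2r slots, hence in t <= 2rm items; let M0 be the output distribution
   averaged over fresh samples in these slots. Both outputs are compared with
   M0, and a union bound over the n^(2r) pairs finishes the proof.

   Revealing the t items one by one gives a martingale M0, ..., Mt of output
   distributions, and item-level DP makes consecutive ones
   (eps', delta')-indistinguishable. For each output, clip the likelihood ratio
   of a step to [exp(-eps'), exp(eps')] and divide it by its mean, and let v be
   the product of these factors. Each factor has mean one and lies within 4eps'
   of one, so v has sub-Gaussian moments of all orders, positive and negative,
   and M0 v is close to M0 up to a factor exp(eps). Clipping costs at most
   6delta' in l1 distance per step; this loss is then multiplied by the same
   mean-one factors, so a moment of the total loss stays under control and the
   loss is O(t delta') with high probability, not only on average. Both
   moments are tracked by one potential, and the induction reveals the items in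
   reverse, averaging out one item (and then one user) at a time. *)
Require Import Defs.
From mathcomp Require Import all_boot all_order all_fingroup all_algebra.
From mathcomp Require Import all_classical all_reals all_analysis.
From mathcomp Require Import measurable_realfun ring lra.

Set Implicit Arguments.
Unset Strict Implicit.
Unset Printing Implicit Defensive.

Import Order.TTheory GRing.Theory Num.Theory.

Local Open Scope ring_scope.

(** * Bounded measurable functions *)

Section bounded_measurable.
Context (R : realType) (d : measure_display) (T : measurableType d).
Implicit Types f g : T -> R.

(** Such functions are integrable under every probability measure, so integrability side conditions
    reduce to the closure lemmas below. *)
Definition bounded_measurable f : Prop :=
  measurable_fun [set: T]%classic f /\ exists C : R, forall x, `|f x| <= C.

Lemma bounded_measurable_cst (c : R) : bounded_measurable (fun=> c).
Proof. by split; [exact: measurable_cst | exists `|c|]. Qed.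

Lemma bounded_measurableD f g : bounded_measurable f -> bounded_measurable g ->
  bounded_measurable (fun x => f x + g x).
Proof.
move=> [mf [C fC]] [mg [C' gC']]; split; first exact: measurable_funD.
by exists (C + C') => x; rewrite (le_trans (ler_normD _ _)) ?lerD.
Qed.

Lemma bounded_measurableZ (c : R) f : bounded_measurable f ->
  bounded_measurable (fun x => c * f x).
Proof.
move=> [mf [C fC]]; split.
  by apply: measurable_funM => //; exact: measurable_cst.
by exists (`|c| * C) => x; rewrite normrM ler_wpM2l.
Qed.

Lemma bounded_measurable_norm f : bounded_measurable f ->
  bounded_measurable (fun x => `|f x|).
Proof.
move=> [mf [C fC]]; split; first exact: measurableT_comp.
by exists C => x; rewrite normr_id.
Qed.

Lemma bounded_measurable_sum (I : Type) (s : seq I) (Q : pred I)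
    (f : I -> T -> R) : (forall i, bounded_measurable (f i)) ->
  bounded_measurable (fun x => \sum_(i <- s | Q i) f i x).
Proof.
move=> bf; elim: s => [|i s IH].
  under eq_fun do rewrite big_nil; exact: bounded_measurable_cst.
under eq_fun do rewrite big_cons.
by case: (Q i) => //; exact: bounded_measurableD.
Qed.

Lemma bounded_measurable01 f : measurable_fun [set: T]%classic f ->
  (forall x, 0 <= f x <= 1) -> bounded_measurable f.
Proof.
by move=> mf f01; split=> //; exists 1 => x; case/andP: (f01 x) => /ger0_norm->.
Qed.

End bounded_measurable.

Lemma bounded_measurable_comp (R : realType) (d d' : measure_display)
    (T : measurableType d) (T' : measurableType d') (f : T' -> R)
    (g : T -> T') : measurable_fun [set: T]%classic g -> bounded_measurable f ->
  bounded_measurable (fun x => f (g x)).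
Proof.
by move=> mg [mf [C fC]]; split; [exact: measurableT_comp | exists C].
Qed.

(** * Expectations, Fubini and integration against [iid] *)

Section expectation.
Context (R : realType) (d : measure_display) (T : measurableType d).
Variable P : probability T R.
Implicit Types f g : T -> R.

Lemma bounded_measurable_integrable f : bounded_measurable f ->
  P.-integrable [set: T]%classic (EFin \o f).
Proof.
move=> [mf [C fC]]; apply: measurable_bounded_integrable => //.
  exact: fin_num_fun_lty (fin_num_measure _).
exists C; split; first exact: num_real.
by move=> y Cy x _; apply: (le_trans (fC x)); exact: ltW.
Qed.

Lemma expect_le f g : bounded_measurable f -> bounded_measurable g ->
  (forall x, f x <= g x) -> \int[P]_x f x <= \int[P]_x g x.
Proof.
by move=> bf bg fg; apply: le_Rintegral => //; exact: bounded_measurable_integrable.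
Qed.

Lemma expectD f g : bounded_measurable f -> bounded_measurable g ->
  \int[P]_x (f x + g x) = \int[P]_x f x + \int[P]_x g x.
Proof.
by move=> bf bg; apply: RintegralD => //; exact: bounded_measurable_integrable.
Qed.

Lemma expectZ (c : R) f : bounded_measurable f ->
  \int[P]_x (c * f x) = c * \int[P]_x f x.
Proof.
by move=> bf; apply: RintegralZl => //; exact: bounded_measurable_integrable.
Qed.

Lemma expect_cst (c : R) : \int[P]_x c = c.
Proof.
rewrite Rintegral_cst //.
by have /= -> := probability_setT P; rewrite mulr1.
Qed.

Lemma expect_sum (I : Type) (s : seq I) (Q : pred I) (f : I -> T -> R) :
  (forall i, bounded_measurable (f i)) ->
  \int[P]_x (\sum_(i <- s | Q i) f i x) = \sum_(i <- s | Q i) \int[P]_x f i x.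
Proof.
move=> bf; elim: s => [|i s IH].
  by rewrite big_nil; under eq_fun do rewrite big_nil; exact: expect_cst.
under eq_fun do rewrite big_cons.
rewrite big_cons; case: (Q i) => //.
rewrite (expectD (bf i)) ?IH //; exact: bounded_measurable_sum.
Qed.

Lemma expect_norm_le f : bounded_measurable f ->
  `|\int[P]_x f x| <= \int[P]_x `|f x|.
Proof.
by move=> bf; apply: le_normr_Rintegral => //; exact: bounded_measurable_integrable.
Qed.

Lemma expect_indic (B : set T) : measurable B ->
  (\int[P]_x (\1_B x : R))%:E = P B.
Proof.
move=> mB; rewrite /Rintegral integral_indic // setIT fineK //.
exact: fin_num_measure.
Qed.

Lemma expect01 f : measurable_fun [set: T]%classic f ->
  (forall x, 0 <= f x <= 1) -> 0 <= \int[P]_x f x <= 1.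
Proof.
move=> mf f01; have bf := bounded_measurable01 mf f01.
rewrite -{1}(expect_cst 0) -(expect_cst 1) !expect_le //;
  by [exact: bounded_measurable_cst | move=> x; case/andP: (f01 x)].
Qed.

End expectation.

Section expectation_product.
Context (R : realType) (d1 d2 : measure_display) (T1 : measurableType d1)
  (T2 : measurableType d2) (P1 : probability T1 R) (P2 : probability T2 R).
Variable f : T1 * T2 -> R.
Hypothesis bf : bounded_measurable f.

Let intf : (P1 \x P2)%E.-integrable [set: T1 * T2]%classic (EFin \o f).
Proof.
case: bf => mf [C fC]; apply: measurable_bounded_integrable => //.
  by have /= -> := probability_setT (P1 \x P2)%E; rewrite ltry.
exists C; split; first exact: num_real.
by move=> y Cy x _; apply: (le_trans (fC x)); exact: ltW.
Qed.

Let bfx x : bounded_measurable (fun y => f (x, y)).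
Proof. exact: bounded_measurable_comp. Qed.

Let FE : (fun x => (\int[P2]_y f (x, y))%:E) = fubini_F P2 (EFin \o f).
Proof.
apply/funext => x; rewrite /fubini_F /Rintegral fineK //.
exact: integrable_fin_num (bounded_measurable_integrable P2 (bfx x)).
Qed.

Lemma bounded_measurable_expect_for :
  bounded_measurable (fun x => \int[P2]_y f (x, y)).
Proof.
split.
  by apply/measurable_EFinP; rewrite [_ \o _]FE; exact: measurable_fubini_F intf.
have [_ [C fC]] := bf; exists C => x.
apply: (le_trans (expect_norm_le P2 (bfx x))).
rewrite -[leRHS](expect_cst P2); apply: expect_le => //.
  exact: bounded_measurable_norm.
exact: bounded_measurable_cst.
Qed.

Lemma expect_fubini :
  \int[(P1 \x P2)%E]_z f z = \int[P1]_x \int[P2]_y f (x, y).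
Proof.
rewrite [LHS]/Rintegral -(integral12_prod_meas1 intf) -FE.
by [].
Qed.

End expectation_product.

(** The measurability half of Fubini is stated with a measure on [T1]; a Dirac mass supplies one. *)
Lemma bounded_measurable_expect (R : realType) (d1 d2 : measure_display)
    (T1 : measurableType d1) (T2 : measurableType d2) (P2 : probability T2 R)
    (f : T1 * T2 -> R) : bounded_measurable f ->
  bounded_measurable (fun x => \int[P2]_y f (x, y)).
Proof. exact: (bounded_measurable_expect_for (\d_(point : T1))). Qed.

Lemma expect_distribution (R : realType) (d d' : measure_display)
    (T : measurableType d) (T' : measurableType d') (P : probability T R)
    (X : {mfun T >-> T'}) (f : T' -> R) : bounded_measurable f ->
  \int[distribution P X]_y f y = \int[P]_x f (X x).
Proof.
move=> bf; rewrite /Rintegral integral_distribution //.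
  by apply/measurable_EFinP; case: bf.
apply: (@bounded_measurable_integrable _ _ _ P (fun x => f (X x))).
exact: bounded_measurable_comp.
Qed.

Lemma bounded_measurable_consp (R : realType) (d : measure_display)
    (T : measurableType d) (k : nat) (f : k.+1.-tuple T -> R) :
  bounded_measurable f -> bounded_measurable (fun p => f (@consp _ _ k p)).
Proof. by apply: bounded_measurable_comp; exact: measurable_consp. Qed.

Lemma expect_iidS (R : realType) (d : measure_display) (T : measurableType d)
    (D : probability T R) (k : nat) (f : k.+1.-tuple T -> R) :
  bounded_measurable f ->
  \int[iid D k.+1]_x f x = \int[D]_z \int[iid D k]_y f (@consp _ _ k (z, y)).
Proof.
move=> bf; rewrite /= expect_distribution //.
by rewrite (expect_fubini _ _ (bounded_measurable_consp bf)).
Qed.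

Lemma expect_iid0 (R : realType) (d : measure_display) (T : measurableType d)
    (D : probability T R) (f : 0.-tuple T -> R) :
  bounded_measurable f -> \int[iid D 0]_x f x = f [tuple].
Proof.
move=> [mf _]; rewrite /= /Rintegral integral_dirac //.
  by rewrite diracE in_setT mul1e.
exact/measurable_EFinP.
Qed.

(** * Exponential inequalities behind the moment bounds *)

Section exponential_bounds.
Context (R : realType).
Implicit Types x h eta : R.

(** [expR x <= (1 - x)^-1], and the quadratic times [1 - x] is [1 + x ^+ 2 * (1 - 2 * x)], at least
    1 on this range. *)
Lemma expR_le_quadratic x : x <= 2^-1 -> expR x <= 1 + x + 2 * x ^+ 2.
Proof.
move=> x_le; have x1 : 0 < 1 - x by lra.
have E : expR x <= (1 - x)^-1.
  rewrite -[x in expR x]opprK expRN lef_pV2 ?posrE ?expR_gt0 //.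
  by have := expR_ge1Dx (- x); lra.
apply: (le_trans E); rewrite -[leLHS]mul1r ler_pdivrMr //.
have -> : (1 + x + 2 * x ^+ 2) * (1 - x) = 1 + x ^+ 2 * (1 - 2 * x) by ring.
by rewrite lerDl mulr_ge0 ?sqr_ge0 //; lra.
Qed.

(** Keeping [x] outside the exponential lets it vanish under a mean-zero average, which leaves a
    sub-Gaussian bound. Beyond [2^-1] one has [0 <= x <= 2 * x ^+ 2]. *)
Lemma expR_le_gauss x : expR x <= x + expR (2 * x ^+ 2).
Proof.
have [x_le|x_gt] := leP x 2^-1.
  apply: (le_trans (expR_le_quadratic x_le)).
  by have := expR_ge1Dx (2 * x ^+ 2); lra.
have : expR x <= expR (2 * x ^+ 2).
  by rewrite ler_expR; nra.
lra.
Qed.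

Lemma expR_le_gauss_bounded x (b : R) : x ^+ 2 <= b ->
  expR x <= x + expR (2 * b).
Proof.
move=> xb; apply: (le_trans (expR_le_gauss x)).
by rewrite lerD2l ler_expR ler_pM2l.
Qed.

Lemma sqr_bounded h eta (n : R) : `|h| <= eta ->
  (n * h) ^+ 2 <= n ^+ 2 * eta ^+ 2.
Proof.
move=> h_le; rewrite exprMn ler_wpM2l ?sqr_ge0 //.
by rewrite -(real_normK (num_real h)) ler_sqr ?nnegrE // (le_trans _ h_le).
Qed.

Lemma exprn1D_le h eta n : `|h| <= eta -> -1 <= h ->
  (1 + h) ^+ n <= n%:R * h + expR (2 * (n%:R ^+ 2 * eta ^+ 2)).
Proof.
move=> h_le h1; apply: le_trans (expR_le_gauss_bounded (sqr_bounded _ h_le)).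
rewrite expRM_natl lerXn2r ?nnegrE ?expR_ge0 ?expR_ge1Dx //; lra.
Qed.

(** [(1 + h)^-1 <= expR (- h + 2 * h ^+ 2)]: the linear part goes through the Gaussian bound, the
    quadratic part becomes the extra factor. *)
Lemma exprnV1D_le h eta n : `|h| <= eta -> eta <= 2^-1 ->
  (1 + h)^-1 ^+ n <= (- (n%:R * h) + expR (2 * (n%:R ^+ 2 * eta ^+ 2)))
                     * expR (2 * n%:R * eta ^+ 2).
Proof.
move=> h_le eta_le; have /andP[hl hu] : - 2^-1 <= h <= 2^-1.
  by rewrite -ler_norml (le_trans h_le).
have V : (1 + h)^-1 <= expR (- h + 2 * h ^+ 2).
  apply: le_trans (expR_ge1Dx _); rewrite -[leLHS]mul1r ler_pdivrMr; last by lra.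
  have -> : (1 + (- h + 2 * h ^+ 2)) * (1 + h) = 1 + h ^+ 2 * (1 + 2 * h) by ring.
  by rewrite lerDl mulr_ge0 ?sqr_ge0 //; lra.
have h2 : h ^+ 2 <= eta ^+ 2.
  by have := sqr_bounded 1 h_le; rewrite mul1r expr1n mul1r.
have {V} : (1 + h)^-1 ^+ n <= expR (- h + 2 * h ^+ 2) ^+ n.
  by rewrite lerXn2r ?nnegrE ?expR_ge0 // invr_ge0; lra.
move=> /le_trans; apply; rewrite -expRM_natl.
have -> : n%:R * (- h + 2 * h ^+ 2) = n%:R * - h + 2 * n%:R * h ^+ 2 by ring.
rewrite expRD ler_pM ?expR_ge0 //; last by rewrite ler_expR ler_wpM2l ?mulr_ge0.
by rewrite -mulrN expR_le_gauss_bounded // sqr_bounded // normrN.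
Qed.

End exponential_bounds.

(** * The potential: moments of [v] and clipping loss *)

Section potential.
Context (R : realType) (O : finType).
(* The reference distribution [M0] is tracked through the process
   [M0 o * v o], where [v] is a product of clipped and renormalised likelihood
   ratios. The first two sums are moments of [v], the last term is a moment of
   the total variation distance lost by clipping. *)
Variables (l : nat) (M0 : O -> R) (e0 d eta K B : R).
Hypotheses (M0_ge0 : forall o, 0 <= M0 o) (d_gt0 : 0 < d) (eta_ge0 : 0 <= eta)
  (eta_le : eta <= 2^-1) (K_gt0 : 0 < K) (B_gt0 : 0 < B).

Definition rate : R := 2 * (l.+1%:R ^+ 2 * eta ^+ 2).
Definition loss_rate : R := rate + l%:R * (6 / K).

Definition moments (v : O -> R) : R :=
  \sum_o M0 o * v o ^+ l.+1 + \sum_o M0 o * (v o)^-1 ^+ l.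

Definition loss (F v : O -> R) : R := \sum_o `|M0 o * v o - F o|.

(** Each term is normalised so that a value below 1 is the desired tail estimate, and the
    exponentials in [s] pay for the growth over [s] steps. The offset [K * d] turns the additive
    loss [6 * d] of a step into a factor [1 + 6 / K]. *)
Definition potential (s : nat) (F v : O -> R) : R :=
  expR (s%:R * rate) * (expR (- (l%:R * e0)) / d) * moments v +
  expR (s%:R * loss_rate) * ((loss F v + K * d) / (B * K * d)) ^+ l.

(** The bound is affine in [h], with coefficients [k] chosen before [h]: averaging over a mean-zero
    [h] leaves only the factor [expR rate]. *)
Lemma moments_step (v : O -> R) : (forall o, 0 < v o) ->
  exists k : O -> R, forall h : O -> R, (forall o, `|h o| <= eta) ->
    moments (fun o => v o * (1 + h o)) <=
      expR rate * moments v + \sum_o k o * h o.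
Proof.
move=> v_gt0; exists (fun o => M0 o * v o ^+ l.+1 * l.+1%:R
  - M0 o * (v o)^-1 ^+ l * l%:R * expR (2 * l%:R * eta ^+ 2)) => h h_le.
rewrite /moments mulrDr !mulr_sumr -!big_split /= ler_sum // => o _.
have /andP[hl hu] : - 2^-1 <= h o <= 2^-1.
  by rewrite -ler_norml (le_trans (h_le o)).
have U := @exprn1D_le _ _ _ l.+1 (h_le o).
have {}U := U ltac:(lra).
have V := exprnV1D_le l (h_le o) eta_le.
(* [rate] is built on [l.+1], so it also absorbs the extra factor: [l ^ 2 + l <= (l + 1) ^ 2]. *)
have V' : (1 + h o)^-1 ^+ l <=
    - (l%:R * h o) * expR (2 * l%:R * eta ^+ 2) + expR rate.
  apply: (le_trans V); rewrite mulrDl lerD2l -expRD ler_expR /rate.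
  have -> : 2 * (l%:R ^+ 2 * eta ^+ 2) + 2 * l%:R * eta ^+ 2 =
    2 * ((l%:R ^+ 2 + l%:R) * eta ^+ 2) by ring.
  rewrite ler_pM2l // ler_wpM2r ?sqr_ge0 // -natr1.
  have : 0 <= l%:R :> R by []. nra.
have a_ge0 : 0 <= M0 o * v o ^+ l.+1 by rewrite mulr_ge0 // exprn_ge0 // ltW.
have b_ge0 : 0 <= M0 o * (v o)^-1 ^+ l.
  by rewrite mulr_ge0 // exprn_ge0 // invr_ge0 ltW.
have := ler_wpM2l a_ge0 U; have := ler_wpM2l b_ge0 V'; rewrite -/rate.
rewrite invfM !exprMn.
move: (v o ^+ l.+1) ((v o)^-1 ^+ l) ((1 + h o) ^+ _) ((1 + h o)^-1 ^+ _).
move: (expR rate) (expR _) (l%:R) (l.+1%:R) => E E' n n' a b a' b'; lra.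
Qed.

(** The loss already incurred is reweighted by [1 + h], and the fresh error [6 * d] is charged to
    the offset [K * d]. As for the moments, what remains is affine in [h]. *)
Lemma loss_step (p v : O -> R) :
  exists k : O -> R, forall h F : O -> R, (forall o, `|h o| <= eta) ->
    \sum_o `|(1 + h o) * p o - F o| <= 6 * d ->
    ((loss F (fun o => v o * (1 + h o)) + K * d) / (B * K * d)) ^+ l <=
      expR loss_rate * ((loss p v + K * d) / (B * K * d)) ^+ l
      + \sum_o k o * h o.
Proof.
pose a o : R := `|M0 o * v o - p o|; pose Y := loss p v + K * d.
have a_ge0 o : 0 <= a o by exact: normr_ge0.
have Kd : 0 < K * d by rewrite mulr_gt0.
have Y_gt0 : 0 < Y by rewrite ltr_wpDl // sumr_ge0.
pose Q := Y / (B * K * d).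
have Q_ge0 : 0 <= Q by rewrite ltW // divr_gt0 // -mulrA mulr_gt0.
exists (fun o => expR (l%:R * (6 / K)) * Q ^+ l * (l%:R * (a o / Y))) => h F h_le HF.
have h1 o : 0 <= 1 + h o.
  by have := h_le o; rewrite ler_norml => /andP[]; move: eta_le; lra.
(* The weights [a o / Y] sum to at most 1 because [Y] contains the whole loss, so [ht] is linear in
   [h] and still bounded by [eta]. *)
pose ht := \sum_o (a o / Y) * h o.
have ht_le : `|ht| <= eta.
  apply: (le_trans (ler_norm_sum _ _ _)).
  apply: (@le_trans _ _ (\sum_o (a o / Y) * eta)).
    apply: ler_sum => o _; rewrite normrM ger0_norm ?divr_ge0 ?(ltW Y_gt0) //.
    by rewrite ler_wpM2l // divr_ge0 ?(ltW Y_gt0).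
  rewrite -mulr_suml -mulr_suml ler_piMl // ler_pdivrMr // mul1r.
  by rewrite lerDl ltW.
have X_le : loss F (fun o => v o * (1 + h o)) <=
    \sum_o (1 + h o) * a o + 6 * d.
  apply: le_trans (lerD (lexx _) HF); rewrite -big_split /= ler_sum // => o _.
  rewrite /a -{2}[1 + h o]ger0_norm // -normrM.
  apply: le_trans (ler_normD _ _); rewrite le_eqVlt; apply/orP; left.
  by apply/eqP; congr (`|_|); ring.
have S_ge0 : 0 <= \sum_o (1 + h o) * a o.
  by rewrite sumr_ge0 // => o _; rewrite mulr_ge0.
have SE : \sum_o (1 + h o) * a o + K * d = Y * (1 + ht).
  rewrite /ht mulrDr mulr1 mulr_sumr.
  have -> : \sum_o Y * (a o / Y * h o) = \sum_o a o * h o.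
    by apply: eq_bigr => o _; field; exact: lt0r_neq0.
  rewrite /Y -addrA [K * d + _]addrC addrA; congr (_ + _).
  by rewrite -big_split /=; apply: eq_bigr => o _; rewrite mulrDl mul1r mulrC.
have Y'_le : (loss F (fun o => v o * (1 + h o)) + K * d) / (B * K * d) <=
    expR (6 / K) * (Q * (1 + ht)).
  rewrite /Q [Y / _ * _]mulrAC mulrA ler_wpM2r //.
    by rewrite invr_ge0 !mulr_ge0 ?ltW.
  (* [Y * (1 + ht)] is at least [K * d], hence [6 * d] is at most [6 / K] times it. *)
  have le1 : loss F (fun o => v o * (1 + h o)) + K * d <=
     (1 + 6 / K) * (Y * (1 + ht)).
    rewrite -SE; apply: (@le_trans _ _ (\sum_o (1 + h o) * a o + 6 * d + K * d)).
      by rewrite lerD2r.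
    rewrite [leRHS]mulrDl mul1r [leLHS]addrAC lerD2l mulrDr.
    have -> : 6 / K * (K * d) = 6 * d by field; exact: lt0r_neq0.
    by rewrite lerDr mulr_ge0 // divr_ge0 // ltW.
  apply: (le_trans le1); rewrite ler_wpM2r ?expR_ge1Dx //.
  by rewrite -SE addr_ge0 // ltW.
have ht1 : -1 <= ht.
  by have := ht_le; rewrite ler_norml => /andP[]; move: eta_le; lra.
have L_ge0 : 0 <= (loss F (fun o => v o * (1 + h o)) + K * d) / (B * K * d).
  by rewrite divr_ge0 ?addr_ge0 ?sumr_ge0 -?mulrA ?mulr_ge0 ?ltW.
have pow_le : ((loss F (fun o => v o * (1 + h o)) + K * d) / (B * K * d)) ^+ l
    <= (expR (6 / K) * (Q * (1 + ht))) ^+ l.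
  by rewrite lerXn2r ?nnegrE // (le_trans L_ge0).
rewrite -/Y -/Q; apply: (le_trans pow_le).
rewrite exprMn [(Q * _) ^+ _]exprMn -expRM_natl.
have htn : (1 + ht) ^+ l <= l%:R * ht + expR rate.
  apply: (le_trans (@exprn1D_le _ _ _ l ht_le ht1)).
  rewrite lerD2l ler_expR /rate ler_pM2l // ler_wpM2r ?sqr_ge0 //.
  by rewrite ler_sqr ?nnegrE // ler_nat.
have c_ge0 : 0 <= expR (l%:R * (6 / K)) * Q ^+ l.
  by rewrite mulr_ge0 ?expR_ge0 ?exprn_ge0.
apply: le_trans (_ : _ <= expR (l%:R * (6 / K)) * Q ^+ l * (l%:R * ht + expR rate)) _.
  by rewrite mulrA ler_wpM2l.
rewrite /loss_rate expRD -/Q /ht mulr_sumr mulrDr mulr_sumr addrC lerD //.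
  by rewrite le_eqVlt; apply/orP; left; apply/eqP; ring.
by apply: ler_sum => o _; rewrite !mulrA.
Qed.

Lemma potential_step (s : nat) (p v : O -> R) : (forall o, 0 < v o) ->
  exists k : O -> R, forall h F : O -> R, (forall o, `|h o| <= eta) ->
    \sum_o `|(1 + h o) * p o - F o| <= 6 * d ->
    potential s F (fun o => v o * (1 + h o)) <=
      potential s.+1 p v + \sum_o k o * h o.
Proof.
move=> v_gt0; have [k1 H1] := moments_step v_gt0; have [k2 H2] := loss_step p v.
pose c1 := expR (s%:R * rate) * (expR (- (l%:R * e0)) / d).
pose c2 := expR (s%:R * loss_rate).
have c1_ge0 : 0 <= c1 by rewrite !mulr_ge0 ?invr_ge0 ?expR_ge0 // ltW.
have c2_ge0 : 0 <= c2 by rewrite expR_ge0.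
exists (fun o => c1 * k1 o + c2 * k2 o) => h F h_le HF.
have := ler_wpM2l c1_ge0 (H1 h h_le); have := ler_wpM2l c2_ge0 (H2 h F h_le HF).
rewrite /potential -/c1 -/c2.
have -> : \sum_o (c1 * k1 o + c2 * k2 o) * h o =
    c1 * (\sum_o k1 o * h o) + c2 * (\sum_o k2 o * h o).
  by rewrite !mulr_sumr -big_split; apply: eq_bigr => o _ /=; ring.
have -> : expR (s.+1%:R * rate) * (expR (- (l%:R * e0)) / d) = c1 * expR rate.
  by rewrite -natr1 mulrDl mul1r expRD mulrAC.
have -> : expR (s.+1%:R * loss_rate) = c2 * expR loss_rate.
  by rewrite -natr1 mulrDl mul1r expRD.
lra.
Qed.

Lemma potential_ge0 (s : nat) (F v : O -> R) : (forall o, 0 < v o) ->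
  0 <= potential s F v.
Proof.
move=> v_gt0; rewrite addr_ge0 //.
  rewrite !mulr_ge0 ?invr_ge0 ?expR_ge0 ?(ltW d_gt0) //.
  by rewrite addr_ge0 // sumr_ge0 // => o _;
    rewrite mulr_ge0 // exprn_ge0 // ?invr_ge0 ltW.
rewrite mulr_ge0 ?expR_ge0 // exprn_ge0 // divr_ge0 ?addr_ge0 ?sumr_ge0 //;
  by rewrite ?mulr_ge0 ?ltW.
Qed.

(** A Markov-type argument: the moments control the outputs where [v] leaves the interval from
    [expR (- e0)] to [expR e0], and the loss pays for replacing [M0 * v] by [F]. *)
Lemma indist_of_potential_lt1 (F v : O -> R) : 0 <= e0 -> (0 < l)%N ->
  (forall o, 0 <= F o) -> (forall o, 0 < v o) -> potential 0 F v < 1 ->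
  indist e0 (d + expR e0 * (B * K * d)) F M0.
Proof.
move=> e0_ge0 l_gt0 F_ge0 v_gt0.
rewrite /potential !mul0r expR0 !mul1r => pot.
have Xl_ge0 : 0 <= loss F v by rewrite sumr_ge0.
have BKd : 0 < B * K * d by rewrite !mulr_gt0.
have mom_ge0 : 0 <= expR (- (l%:R * e0)) / d * moments v.
  rewrite !mulr_ge0 ?invr_ge0 ?expR_ge0 ?(ltW d_gt0) //.
  by rewrite addr_ge0 // sumr_ge0 // => o _;
    rewrite mulr_ge0 // exprn_ge0 // ?invr_ge0 ltW.
have Q_ge0 : 0 <= (loss F v + K * d) / (B * K * d).
  by rewrite divr_ge0 ?(ltW BKd) // addr_ge0 // mulr_ge0 ?ltW.
have mom_le : expR (- (l%:R * e0)) * moments v <= d.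
  suff : expR (- (l%:R * e0)) / d * moments v <= 1.
    by rewrite mulrAC ler_pdivrMr // mul1r.
  by have := exprn_ge0 l Q_ge0; lra.
have loss_le : loss F v <= B * K * d.
  have : ((loss F v + K * d) / (B * K * d)) ^+ l < 1 by lra.
  rewrite expr_lt1 // ltr_pdivrMr // mul1r => /ltW; apply: le_trans.
  by rewrite lerDl mulr_ge0 ?ltW.
have M1 : expR (- (l%:R * e0)) * \sum_o M0 o * v o ^+ l.+1 <= d.
  apply: le_trans mom_le; rewrite ler_wpM2l ?expR_ge0 // lerDl sumr_ge0 // => o _.
  by rewrite mulr_ge0 // exprn_ge0 // invr_ge0 ltW.
have M2 : expR (- (l%:R * e0)) * \sum_o M0 o * (v o)^-1 ^+ l <= d.
  apply: le_trans mom_le; rewrite ler_wpM2l ?expR_ge0 // lerDr sumr_ge0 // => o _.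
  by rewrite mulr_ge0 // exprn_ge0 // ltW.
have e1 : 1 <= expR e0 by rewrite -expR0 ler_expR.
have powE : expR (- (l%:R * e0)) = (expR e0)^-1 ^+ l by rewrite expRN expRM_natl exprVn.
split.
- apply: (@le_trans _ _ (expR (- (l%:R * e0)) * (\sum_o M0 o * v o ^+ l.+1)
                         + loss F v)); last first.
    by rewrite lerD // (le_trans loss_le) // ler_peMl // ltW.
  rewrite mulr_sumr -big_split /= ler_sum // => o _.
  have v0 := v_gt0 o; have m0 := M0_ge0 o.
  rewrite ge_max; apply/andP; split; last first.
    by rewrite addr_ge0 // !mulr_ge0 ?expR_ge0 ?exprn_ge0 // ltW.
  have : F o <= M0 o * v o + `|M0 o * v o - F o|.
    by have := ler_norm (F o - M0 o * v o); rewrite distrC; lra.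
  suff : M0 o * v o - expR e0 * M0 o <= expR (- (l%:R * e0)) * (M0 o * v o ^+ l.+1).
    by lra.
  rewrite mulrCA mulrC -mulrBl [leRHS]mulrC ler_wpM2r //.
  (* Only [v o > expR e0] matters. There [(v o / expR e0) ^ l >= 1], and the remaining factor [v o]
     explains the exponent [l.+1]. *)
  have [ve|ve] := leP (v o) (expR e0).
    apply: (@le_trans _ _ 0); first by lra.
    by rewrite mulr_ge0 ?expR_ge0 ?exprn_ge0 // ltW.
  apply: (@le_trans _ _ (v o)); first by have := expR_ge0 e0; lra.
  rewrite powE exprS mulrCA -exprMn ler_peMr ?(ltW v0) // exprn_ege1 //.
  by rewrite mulrC ler_pdivlMr ?expR_gt0 // mul1r ltW.
- apply: (@le_trans _ _ (expR (- (l%:R * e0)) * (\sum_o M0 o * (v o)^-1 ^+ l)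
                         + expR e0 * loss F v)); last first.
    by rewrite lerD // ler_wpM2l ?expR_ge0.
  rewrite !mulr_sumr -big_split /= ler_sum // => o _.
  have v0 := v_gt0 o; have m0 := M0_ge0 o.
  have vl0 : 0 <= (v o)^-1 ^+ l by rewrite exprn_ge0 // invr_ge0 ltW.
  rewrite ge_max; apply/andP; split; last first.
    by rewrite addr_ge0 // !mulr_ge0 ?expR_ge0.
  have : expR e0 * (M0 o * v o) <= expR e0 * F o + expR e0 * `|M0 o * v o - F o|.
    by rewrite -mulrDr ler_wpM2l ?expR_ge0 //; have := ler_norm (M0 o * v o - F o); lra.
  suff : M0 o - expR e0 * (M0 o * v o) <= expR (- (l%:R * e0)) * (M0 o * (v o)^-1 ^+ l).
    by lra.
  rewrite mulrCA [leRHS]mulrCA -{1}[M0 o]mulr1 -mulrBr ler_wpM2l //.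
  (* Here the left side is at most 1, so the power [l] of the inverse is enough. *)
  have [ve|ve] := leP 1 (expR e0 * v o).
    apply: (@le_trans _ _ 0); first by lra.
    by rewrite mulr_ge0 ?expR_ge0.
  apply: (@le_trans _ _ 1); first by rewrite gerBl mulr_ge0 ?expR_ge0 // ltW.
  rewrite powE -exprMn -invfM exprn_ege1 // -[leLHS]invr1.
  by rewrite lef_pV2 ?posrE ?mulr_gt0 ?expR_gt0 // ltW.
Qed.

End potential.

(** * Differential privacy under averaging *)

Section averaging.
Context (R : realType) (O : finType) (eps delta : R).

(** The neighbouring relation is a parameter, so that one notion serves a single sample, a user's
    tuple and a tuple of users. *)
Definition dp_on (T : Type) (nbr : T -> T -> Prop) (F : T -> O -> R) : Prop :=
  forall x x', nbr x x' -> forall S : {set O},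
    \sum_(o in S) F x o <= expR eps * \sum_(o in S) F x' o + delta.

Definition tuple_nbr (T : Type) (nbr : T -> T -> Prop) (k : nat)
    (x x' : k.-tuple T) : Prop :=
  exists i, nbr (tnth x i) (tnth x' i) /\
    forall i', i' <> i -> tnth x i' = tnth x' i'.

Definition mean (d : measure_display) (T : measurableType d)
    (P : probability T R) (F : T -> O -> R) (o : O) : R := \int[P]_x F x o.

Section mechanism.
Context (d : measure_display) (T : measurableType d) (F : mechanism R T O).

Lemma outprob_le1 x o : F x o <= 1.
Proof.
rewrite -(outprob_sum1 F x) (bigD1 o) //= lerDl sumr_ge0 // => o' _.
exact: outprob_ge0.
Qed.

Lemma bounded_measurable_outprob o : bounded_measurable (fun x => F x o).
Proof.
apply: bounded_measurable01; first exact: measurable_outprob.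
by move=> x; rewrite outprob_ge0 outprob_le1.
Qed.

Lemma bounded_measurable_outprob_sum (S : {set O}) :
  bounded_measurable (fun x => \sum_(o in S) F x o).
Proof. exact: bounded_measurable_sum bounded_measurable_outprob. Qed.

Variable P : probability T R.

Lemma mean_ge0 o : 0 <= mean P F o.
Proof. by apply: Rintegral_ge0 => x _; exact: outprob_ge0. Qed.

Lemma mean_sum (S : {set O}) :
  \sum_(o in S) mean P F o = \int[P]_x \sum_(o in S) F x o.
Proof. by rewrite (expect_sum P) //; exact: bounded_measurable_outprob. Qed.

Lemma mean_sum1 : \sum_o mean P F o = 1.
Proof.
rewrite -(expect_sum P _ _ bounded_measurable_outprob).
under eq_fun do rewrite outprob_sum1.
exact: expect_cst.
Qed.

End mechanism.

Definition comp_mechanism (d d' : measure_display) (T : measurableType d)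
    (T' : measurableType d') (F : mechanism R T' O) (g : T -> T')
    (mg : measurable_fun [set: T]%classic g) : mechanism R T O :=
  @Mechanism R d T O (fun x => F (g x)) (fun x o => outprob_ge0 F (g x) o)
    (fun x => outprob_sum1 F (g x))
    (fun o => measurableT_comp (measurable_outprob F o) mg).

Section partial_mean.
Context (d1 d2 : measure_display) (T1 : measurableType d1)
  (T2 : measurableType d2) (P2 : probability T2 R).
Variable F : mechanism R (T1 * T2)%type O.

Lemma measurable_mean o :
  measurable_fun [set: T1]%classic (fun x => mean P2 (fun y => F (x, y)) o).
Proof.
by have [] := bounded_measurable_expect P2 (bounded_measurable_outprob F o).
Qed.

Definition section_mechanism (x : T1) : mechanism R T2 O :=
  comp_mechanism F (pair1_measurable x).

Definition partial_mean : mechanism R T1 O :=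
  @Mechanism R d1 T1 O (fun x => mean P2 (fun y => F (x, y)))
    (fun x => mean_ge0 (section_mechanism x) P2)
    (fun x => mean_sum1 (section_mechanism x) P2) measurable_mean.

Lemma dp_partial_mean (nbr : T1 -> T1 -> Prop) :
  (forall y, dp_on nbr (fun x => F (x, y))) -> dp_on nbr partial_mean.
Proof.
move=> dpF x x' xx' S.
rewrite !(mean_sum (section_mechanism _) P2) -(expectZ P2); last first.
  exact: (bounded_measurable_outprob_sum (section_mechanism x')).
rewrite -[delta](expect_cst P2) -(expectD P2); last 2 first.
- by apply: bounded_measurableZ;
    exact: (bounded_measurable_outprob_sum (section_mechanism x')).
- exact: bounded_measurable_cst.
apply: expect_le.
- exact: (bounded_measurable_outprob_sum (section_mechanism x)).
- apply: bounded_measurableD; last exact: bounded_measurable_cst.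
  by apply: bounded_measurableZ;
    exact: (bounded_measurable_outprob_sum (section_mechanism x')).
- by move=> y; exact: dpF.
Qed.

End partial_mean.

(* [B s F q] says that, with [s] steps of the process already run, an event
   about an output distribution [F] has probability at most its potential.
   Averaging over a sample space costs [t] further steps. *)
Variable B : nat -> (O -> R) -> R -> Prop.

Definition averages (d : measure_display) (T : measurableType d)
    (P : probability T R) (nbr : T -> T -> Prop) (t : nat) : Prop :=
  forall (F : mechanism R T O) (q : T -> R) (s : nat), dp_on nbr F ->
    measurable_fun [set: T]%classic q -> (forall x, 0 <= q x <= 1) ->
    (forall x, B s (F x) (q x)) -> B (s + t) (mean P F) (\int[P]_x q x).

(** Induction on the length. For a fixed head the tail is averaged first, at cost [k * t], which
    turns [F] into a [partial_mean] and [q] into a conditional expectation; the head then costs [t].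
    Privacy in the head survives because its inequality can be integrated over the tail. *)
Lemma averages_iid (d : measure_display) (T : measurableType d)
    (D : probability T R) (nbr : T -> T -> Prop) (t k : nat) :
  averages D nbr t -> averages (iid D k) (@tuple_nbr T nbr k) (k * t).
Proof.
move=> avD; elim: k => [|k IH] F q s dpF mq q01 BFq.
  rewrite addn0 (expect_iid0 D (bounded_measurable01 mq q01)).
  rewrite (_ : mean _ _ = F [tuple]); first exact: BFq.
  by apply/funext => o; rewrite /mean (expect_iid0 D (bounded_measurable_outprob F o)).
pose G := comp_mechanism F (@measurable_consp _ T k).
have -> : mean (iid D k.+1) F = mean D (partial_mean (iid D k) G).
  apply/funext => o.
  by rewrite /mean (expect_iidS D (bounded_measurable_outprob F o)).
have bq := bounded_measurable_consp (bounded_measurable01 mq q01).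
rewrite (expect_iidS D (bounded_measurable01 mq q01)) mulSn [(t + _)%N]addnC addnA.
apply: avD.
- apply: dp_partial_mean => y z z' zz' S; apply: dpF.
  exists ord0; split; first by rewrite !tnth0.
  by move=> i'; case: (unliftP ord0 i') => [j|] -> // _; rewrite !tnthS.
- by have [] := bounded_measurable_expect (iid D k) bq.
- move=> z; apply: expect01 => [|y]; last exact: q01.
  exact: measurableT_comp bq.1 (pair1_measurable z).
- move=> z; apply: (IH (section_mechanism G z)).
  + move=> y y' [i [yy' Nyy']] S; apply: dpF; exists (lift ord0 i).
    split; first by rewrite !tnthS.
    move=> i'; case: (unliftP ord0 i') => [j|] -> ij; rewrite ?tnth0 // !tnthS.
    by apply: Nyy' => ji; apply: ij; rewrite ji.
  + exact: measurableT_comp bq.1 (pair1_measurable z).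
  + by move=> y; exact: q01.
  + by move=> y; exact: BFq.
Qed.

End averaging.

(** * One sample: clipped and renormalised likelihood ratios *)

Section one_sample.
Context (R : realType) (O : finType).

(** The sum of positive parts is attained by the event [g o < f o]. *)
Lemma sum_max0_le (f g : O -> R) (delta : R) :
  (forall S : {set O}, \sum_(o in S) f o <= \sum_(o in S) g o + delta) ->
  \sum_o Num.max (f o - g o) 0 <= delta.
Proof.
move=> H; have := H [set o | g o < f o].
rewrite -lerBlDl -sumrB; apply: le_trans.
rewrite (bigID (fun o => o \in [set o | g o < f o])) /=.
rewrite [X in _ + X]big1 ?addr0 => [|o]; last first.
  by rewrite inE -leNgt => fg; rewrite max_r // subr_le0.
by apply: ler_sum => o; rewrite inE => gf; rewrite max_l // subr_ge0 ltW.
Qed.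

Definition clip (eps x : R) : R :=
  Num.max (expR (- eps)) (Num.min (expR eps) x).

Lemma clip_bounds (eps x : R) : 0 <= eps ->
  expR (- eps) <= clip eps x <= expR eps.
Proof.
move=> eps_ge0; rewrite le_max lexx /= ge_max ge_min lexx andbT.
by rewrite ler_expR; lra.
Qed.

Lemma clip_ratio_dist (eps p x : R) : 0 <= eps -> 0 <= p -> 0 <= x ->
  `|clip eps (x / p) * p - x| <=
    Num.max (x - expR eps * p) 0 + Num.max (p - expR eps * x) 0.
Proof.
move=> eps_ge0; have e1 : 1 <= expR eps by rewrite -expR0 ler_expR.
(* At [p = 0] the ratio is multiplied by zero, and the error is all of [x], which the first term
   covers. *)
rewrite le_eqVlt => /predU1P[<-|p_gt0] x_ge0.
  by rewrite !mulr0 sub0r normrN subr0 ger0_norm // max_l // lerDl le_max lexx orbT.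
have m1 : 0 <= Num.max (x - expR eps * p) 0 by rewrite le_max lexx orbT.
have m2 : 0 <= Num.max (p - expR eps * x) 0 by rewrite le_max lexx orbT.
have M1 : x - expR eps * p <= Num.max (x - expR eps * p) 0 by rewrite le_max lexx.
have M2 : p - expR eps * x <= Num.max (p - expR eps * x) 0 by rewrite le_max lexx.
rewrite /clip; have [le1|gt1] := leP (expR eps) (x / p).
  rewrite max_r; last by rewrite ler_expR; lra.
  move: le1; rewrite ler_pdivlMr // => le1.
  by rewrite distrC ger0_norm ?subr_ge0 // (le_trans M1) // lerDl.
have [le2|gt2] := leP (expR (- eps)) (x / p).
  by rewrite mulfVK ?lt0r_neq0 // subrr normr0 addr_ge0.
move: gt2; rewrite ltr_pdivrMr // => gt2.
rewrite ger0_norm; last by rewrite subr_ge0 ltW.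
(* The gap [expR (- eps) * p - x] is scaled by [expR eps >= 1]. *)
apply: (@le_trans _ _ (p - expR eps * x)); last by rewrite (le_trans M2) // lerDr.
have E : expR eps * expR (- eps) = 1 by rewrite expRxMexpNx_1.
have : 0 <= expR (- eps) by exact: expR_ge0.
nra.
Qed.

Context (d : measure_display) (Z : measurableType d) (D : probability Z R).
Variables (F : mechanism R Z O) (eps delta : R).
Hypotheses (eps_ge0 : 0 <= eps) (eps_le : eps <= 8^-1).
Hypothesis dpF : dp_on eps delta (fun _ _ : Z => True) F.

Let p := mean D F.
Let c z o := clip eps (F z o / p o).
Let mu o := \int[D]_z c z o.

(** [1 + ratio_noise] is the factor that multiplies [v] when one sample is revealed. *)
Definition ratio_noise (z : Z) (o : O) : R := c z o / mu o - 1.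

Let c_bounds z o : expR (- eps) <= c z o <= expR eps.
Proof. exact: clip_bounds. Qed.

Let bc o : bounded_measurable (fun z => c z o).
Proof.
split.
  apply: measurable_maxr; first exact: measurable_cst.
  apply: measurable_minr; first exact: measurable_cst.
  apply: measurable_funM; last exact: measurable_cst.
  exact: measurable_outprob.
exists (expR eps) => z; have /andP[c1 c2] := c_bounds z o.
by rewrite ger0_norm // (le_trans _ c1) // expR_ge0.
Qed.

Let mu_bounds o : expR (- eps) <= mu o <= expR eps.
Proof.
have bcst := @bounded_measurable_cst R _ Z.
apply/andP; split; [rewrite -[leLHS](expect_cst D) | rewrite -[leRHS](expect_cst D)];
  by apply: expect_le => // z; case/andP: (c_bounds z o).
Qed.

Let mu_gt0 o : 0 < mu o.
Proof. by have /andP[+ _] := mu_bounds o; apply: lt_le_trans; exact: expR_gt0. Qed.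

Lemma bounded_measurable_ratio_noise o :
  bounded_measurable (fun z => ratio_noise z o).
Proof.
rewrite /ratio_noise; apply: bounded_measurableD; last exact: bounded_measurable_cst.
under eq_fun do rewrite mulrC; exact: bounded_measurableZ.
Qed.

Lemma ratio_noise_mean0 o : \int[D]_z ratio_noise z o = 0.
Proof.
rewrite /ratio_noise; under eq_fun do rewrite mulrC.
rewrite expectD; [|exact: bounded_measurableZ|exact: bounded_measurable_cst].
by rewrite expectZ // expect_cst mulVf ?subrr // lt0r_neq0.
Qed.

(** Both [c] and [mu] lie between [expR (- eps)] and [expR eps], so the deviation is [2 * eps] to
    first order; the slack up to [4 * eps] absorbs the rest. *)
Lemma ratio_noise_le z o : `|ratio_noise z o| <= 4 * eps.
Proof.
have /andP[c1 c2] := c_bounds z o; have /andP[m1 m2] := mu_bounds o.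
have E : expR (- eps) * expR eps = 1 by rewrite mulrC expRxMexpNx_1.
have lo := expR_ge1Dx (- eps).
have up : expR eps <= 1 + eps + 2 * eps ^+ 2.
  by apply: expR_le_quadratic; move: eps_le; lra.
have e_gt0 : 0 < expR eps := expR_gt0 _.
rewrite ler_norml /ratio_noise lerBrDr lerBlDr.
rewrite ler_pdivlMr ?mu_gt0 // ler_pdivrMr ?mu_gt0 //.
move: eps_le eps_ge0 => e8 e0; apply/andP; split.
  apply: le_trans c1; apply: (@le_trans _ _ ((1 - 4 * eps) * expR eps)).
    by rewrite [- _ + 1]addrC ler_wpM2l //; lra.
  apply: le_trans lo; apply: (@le_trans _ _ ((1 - 4 * eps) * (1 + eps + 2 * eps ^+ 2))).
    by rewrite ler_wpM2l //; lra.
  nra.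
apply: (le_trans c2).
apply: (@le_trans _ _ ((4 * eps + 1) * expR (- eps))); last first.
  by rewrite ler_wpM2l //; lra.
apply: (@le_trans _ _ ((4 * eps + 1) * (1 - eps))); last first.
  by rewrite ler_wpM2l //; lra.
nra.
Qed.

Let dp_mean z (S : {set O}) :
  \sum_(o in S) F z o <= expR eps * \sum_(o in S) p o + delta.
Proof.
have bS := bounded_measurable_outprob_sum F S.
rewrite (mean_sum F) -(expectZ D _ bS).
rewrite -[X in _ + X](expect_cst D) -[leLHS](expect_cst D).
rewrite -expectD; [|exact: bounded_measurableZ|exact: bounded_measurable_cst].
apply: expect_le; first exact: bounded_measurable_cst.
  by apply: bounded_measurableD; [exact: bounded_measurableZ|exact: bounded_measurable_cst].
by move=> z'; exact: dpF.
Qed.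

Let mean_dp z (S : {set O}) :
  \sum_(o in S) p o <= expR eps * \sum_(o in S) F z o + delta.
Proof.
rewrite (mean_sum F) -[leRHS](expect_cst D).
apply: expect_le; first exact: bounded_measurable_outprob_sum.
  exact: bounded_measurable_cst.
by move=> z'; exact: dpF.
Qed.

Let clip_loss z : \sum_o `|c z o * p o - F z o| <= 2 * delta.
Proof.
apply: (@le_trans _ _ (\sum_o Num.max (F z o - expR eps * p o) 0
                     + \sum_o Num.max (p o - expR eps * F z o) 0)).
  rewrite -big_split ler_sum // => o _; apply: clip_ratio_dist => //.
    exact: mean_ge0.
  exact: outprob_ge0.
have -> : 2 * delta = delta + delta by ring.
rewrite lerD //; apply: sum_max0_le => S; rewrite -mulr_sumr.
  exact: dp_mean.
exact: mean_dp.
Qed.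

(** Clipping costs [2 * delta], one [delta] for each direction of the privacy inequality.
    Renormalising costs [4 * delta]: a shift of [2 * delta] times a factor [1 + ratio_noise], at
    most 2. *)
Lemma ratio_noise_loss z :
  \sum_o `|(1 + ratio_noise z o) * p o - F z o| <= 6 * delta.
Proof.
have bdiff o : bounded_measurable (fun z => c z o * p o - F z o).
  apply: bounded_measurableD.
    by under eq_fun do rewrite mulrC; exact: bounded_measurableZ.
  under eq_fun do rewrite -mulN1r.
  by apply: bounded_measurableZ; exact: bounded_measurable_outprob.
(* Since [p] is the mean of [F], [(mu o - 1) * p o] is the mean of the clipping error. *)
have mu_loss : \sum_o `|(mu o - 1) * p o| <= 2 * delta.
  rewrite -[leRHS](expect_cst D).
  apply: (@le_trans _ _ (\int[D]_z \sum_o `|c z o * p o - F z o|)).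
    rewrite expect_sum => [|o]; last exact: bounded_measurable_norm.
    apply: ler_sum => o _; apply: le_trans (expect_norm_le D (bdiff o)).
    rewrite expectD; last 2 first.
    - by under eq_fun do rewrite mulrC; exact: bounded_measurableZ.
    - under eq_fun do rewrite -mulN1r.
      by apply: bounded_measurableZ; exact: bounded_measurable_outprob.
    have -> : \int[D]_z (c z o * p o) = mu o * p o.
      by under eq_fun do rewrite mulrC; rewrite expectZ // mulrC.
    have -> : \int[D]_z - F z o = - p o.
      under eq_fun do rewrite -mulN1r.
      by rewrite expectZ ?mulN1r //; exact: bounded_measurable_outprob.
    by rewrite mulrBl mul1r.
  apply: expect_le => //; last exact: bounded_measurable_cst.
  by apply: bounded_measurable_sum => o; exact: bounded_measurable_norm.
apply: (@le_trans _ _ (2 * \sum_o `|(mu o - 1) * p o|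
                       + \sum_o `|c z o * p o - F z o|)); last first.
  have := clip_loss z; lra.
rewrite mulr_sumr -big_split ler_sum // => o _ /=.
have -> : (1 + ratio_noise z o) * p o - F z o =
  - ((1 + ratio_noise z o) * ((mu o - 1) * p o)) + (c z o * p o - F z o).
  by rewrite /ratio_noise; field; exact: lt0r_neq0.
apply: (le_trans (ler_normD _ _)); rewrite lerD2r normrN normrM ler_wpM2r //.
have := ratio_noise_le z o; rewrite ler_norml => /andP[n1 n2].
by rewrite ger0_norm; move: eps_le eps_ge0; lra.
Qed.

End one_sample.

(** * One sample costs one step of the potential *)

Section averages_sample.
Context (R : realType) (O : finType) (d : measure_display)
  (Z : measurableType d) (D : probability Z R).
Variables (l : nat) (M0 : O -> R) (e0 eps delta K B : R).
Hypotheses (M0_ge0 : forall o, 0 <= M0 o) (delta_gt0 : 0 < delta)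
  (eps_ge0 : 0 <= eps) (eps_le : eps <= 8^-1) (K_gt0 : 0 < K) (B_gt0 : 0 < B).

(** The bound is required for every positive [v], because each value of the sample multiplies [v] by
    its own factor. *)
Definition below_potential (s : nat) (F : O -> R) (q : R) : Prop :=
  forall v : O -> R, (forall o, 0 < v o) ->
    q <= potential l M0 e0 delta (4 * eps) K B s F v.

(** The pointwise bound from [potential_step] is affine in the noise, and its linear part integrates
    to zero. *)
Lemma averages_sample :
  averages eps delta below_potential D (fun _ _ => True) 1.
Proof.
move=> F q s dpF mq q01 Bq v v_gt0.
have eta_ge0 : 0 <= 4 * eps by rewrite mulr_ge0.
have eta_le : 4 * eps <= 2^-1 by move: eps_le; lra.
rewrite addn1; have [k Hk] := @potential_step _ _ l M0 e0 delta (4 * eps) K B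
  M0_ge0 delta_gt0 eta_ge0 eta_le K_gt0 B_gt0 s (mean D F) v v_gt0.
pose h := ratio_noise D F eps.
have bh o : bounded_measurable (fun z => h z o).
  exact: bounded_measurable_ratio_noise.
have le_q z : q z <= potential l M0 e0 delta (4 * eps) K B s.+1 (mean D F) v
    + \sum_o k o * h z o.
  have h_le o : `|h z o| <= 4 * eps by exact: ratio_noise_le.
  apply: le_trans (Hk (h z) (F z) h_le _).
    apply: Bq => o; rewrite mulr_gt0 //.
    by have := h_le o; rewrite ler_norml => /andP[+ _]; move: eta_le; lra.
  exact: ratio_noise_loss.
have bkh o : bounded_measurable (fun z => k o * h z o).
  exact: bounded_measurableZ.
have bs : bounded_measurable (fun z => \sum_o k o * h z o).
  exact: bounded_measurable_sum.
apply: (le_trans (expect_le D (bounded_measurable01 mq q01) _ le_q)).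
  by apply: bounded_measurableD => //; exact: bounded_measurable_cst.
rewrite expectD // ?expect_cst //; last exact: bounded_measurable_cst.
rewrite expect_sum // big1 ?addr0 // => o _.
by rewrite expectZ // ratio_noise_mean0 // mulr0.
Qed.

End averages_sample.

(** * Product measures: uniqueness, marginals and concatenation *)

Section iid_uniqueness.
Local Open Scope classical_set_scope.
Context (R : realType) (d : measure_display) (T : measurableType d).
Variables (D : probability T R) (k : nat).

Definition rectangles : set (set (k.-tuple T)) :=
  [set A | exists2 B : 'I_k -> set T, (forall i, measurable (B i)) &
           A = [set x | forall i, B i (tnth x i)]].

Lemma measurable_rectangle A : rectangles A -> measurable A.
Proof.
case=> B mB ->.
rewrite (_ : [set x | _] = \bigcap_(i in [set: 'I_k])
    ((fun x : k.-tuple T => tnth x i) @^-1` B i)).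
  apply: fin_bigcap_measurable => // i _; rewrite -[X in measurable X]setTI.
  exact: measurable_tnth.
by apply/seteqP; split=> x /= H i; [move=> _|]; exact: H.
Qed.

Lemma rectangles_setT : rectangles setT.
Proof.
exists (fun=> setT); first by move=> i; exact: measurableT.
by apply/seteqP; split.
Qed.

(** The tuple sigma-algebra is generated by preimages under coordinates, each a rectangle with one
    side prescribed and all others full. *)
Lemma measurable_tuple_rectangles :
  (@measurable _ (k.-tuple T)) = <<s rectangles >>.
Proof.
apply/seteqP; split; last first.
  apply: smallest_sub; first exact: sigma_algebra_measurable.
  exact: measurable_rectangle.
apply: smallest_sub; first exact: smallest_sigma_algebra.
move=> A; rewrite -bigcup_seq => -[i _ [B mB <-]].
apply: sub_sigma_algebra; exists (fun j => if j == i then B else setT).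
  by move=> j; case: ifP => // _; exact: measurableT.
apply/seteqP; split=> [x [_ Bx] j|x H].
  by case: eqP => [->|].
by split=> //; have := H i; rewrite eqxx.
Qed.

(** Rectangles are closed under intersection and generate, so two finite measures agreeing on them
    coincide. *)
Lemma iid_unique (m : {measure set (k.-tuple T) -> \bar R}) :
  (forall B : 'I_k -> set T, (forall i, measurable (B i)) ->
    m [set x | forall i, B i (tnth x i)] = (\prod_(i < k) D (B i))%E) ->
  forall A, measurable A -> m A = iid D k A.
Proof.
move=> mB A mA.
apply: (measure_unique rectangles (fun=> setT)) => //.
- exact: measurable_tuple_rectangles.
- move=> _ _ [B mB1 ->] [B' mB' ->]; exists (fun i => B i `&` B' i).
    by move=> i; exact: measurableI.
  by apply/seteqP; split=> [x [H1 H2] i|x H]; [split|split=> i; case: (H i)].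
- by move=> _; exact: rectangles_setT.
- by rewrite bigcup_const //; exists 0%N.
- by move=> _ [B mB1 ->]; rewrite mB //; symmetry; exact: iid_rectangle.
- move=> _; have := mB (fun=> setT) (fun=> measurableT).
  rewrite (_ : [set x | _] = setT); last by apply/seteqP; split.
  move=> ->; rewrite big1 ?ltry // => i _; exact: probability_setT.
Qed.

End iid_uniqueness.

Lemma iid_pushforward (R : realType) (d d' : measure_display)
    (T : measurableType d) (W : measurableType d') (D : probability T R)
    (P : probability W R) (k : nat) (f : W -> k.-tuple T) :
  measurable_fun [set: W]%classic f ->
  (forall B : 'I_k -> set T, (forall i, measurable (B i)) ->
    P [set w | forall i, B i (tnth (f w) i)]%classic
    = (\prod_(i < k) D (B i))%E) ->
  forall A, measurable A -> P (f @^-1` A)%classic = iid D k A.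
Proof.
move=> mf Pf A mA.
pose X : {mfun W >-> k.-tuple T} :=
  MeasurableFun.Pack (MeasurableFun.Class (isMeasurableFun.Build _ _ _ _ _ mf)).
exact: (@iid_unique _ _ _ D k (distribution P X)).
Qed.

(** [remove_users L x S] is convertible to [tuple_select (L S) x], so deleting users is selecting
    coordinates. *)
Definition tuple_select (T : Type) (n k : nat) (L : 'I_k -> 'I_n) (x : n.-tuple T) :
  k.-tuple T := [tuple tnth x (L i) | i < k].

Definition tuple_join (T : Type) (a b : nat) (p : a.-tuple T * b.-tuple T) :
  (a + b).-tuple T :=
  [tuple match fintype.split i with inl j => tnth p.1 j | inr j => tnth p.2 j end
  | i < a + b].

Section iid_select_join.
Context (R : realType) (d : measure_display) (T : measurableType d).
Variable D : probability T R.

Lemma measurable_select (n k : nat) (L : 'I_k -> 'I_n) :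
  measurable_fun [set: n.-tuple T]%classic (@tuple_select T n k L).
Proof.
apply/measurable_fun_tnthP => i.
rewrite (_ : _ \o _ = fun x => tnth x (L i)); first exact: measurable_tnth.
by apply/funext => x /=; rewrite tnth_mktuple.
Qed.

Lemma measurable_join (a b : nat) :
  measurable_fun [set: a.-tuple T * b.-tuple T]%classic (@tuple_join T a b).
Proof.
apply/measurable_fun_tnthP => i; case: (split_ordP i) => j ->.
  rewrite (_ : _ \o _ = fun p => tnth p.1 j).
    by apply: (measurableT_comp (measurable_tnth j)).
  by apply/funext => p /=; rewrite tnth_mktuple (unsplitK (inl j)).
rewrite (_ : _ \o _ = fun p => tnth p.2 j).
  by apply: (measurableT_comp (measurable_tnth j)).
by apply/funext => p /=; rewrite tnth_mktuple (unsplitK (inr j)).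
Qed.

Lemma iid_select (n k : nat) (L : 'I_k -> 'I_n) : injective L ->
  forall A, measurable A -> iid D n (@tuple_select T n k L @^-1` A)%classic = iid D k A.
Proof.
move=> injL; apply: iid_pushforward; first exact: measurable_select.
move=> B mB.
(* Coordinates outside the image of [L] get the full space and contribute a factor 1. *)
pose B' j := if [pick i | L i == j] is Some i then B i else [set: T]%classic.
have B'L i : B' (L i) = B i.
  rewrite /B'; case: pickP => [i' /eqP /injL -> //|/(_ i)]; by rewrite eqxx.
have mB' j : measurable (B' j).
  by rewrite /B'; case: pickP => // _ _; exact: measurableT.
rewrite (_ : [set w | _]%classic = [set x | forall j, B' j (tnth x j)]%classic).
  rewrite (iid_rectangle D mB') (bigID (mem (codom L))) /=.
  rewrite [X in (_ * X)%E]big1 => [|j jL]; last first.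
    rewrite /B'; case: pickP => [i /eqP Lij|_]; last exact: probability_setT.
    by rewrite -Lij codom_f in jL.
  have uL : uniq (codom L) by rewrite map_inj_uniq ?enum_uniq.
  rewrite mule1 -(big_uniq _ uL) /= big_image /=.
  by apply: eq_bigr => i _; rewrite B'L.
apply/seteqP; split=> [x /= H j|x /= H i].
  rewrite /B'; case: pickP => [i /eqP <-|//].
  by have := H i; rewrite tnth_mktuple.
by rewrite tnth_mktuple -B'L.
Qed.

Lemma iid_join (a b : nat) (A : set ((a + b).-tuple T)) : measurable A ->
  (iid D a \x iid D b)%E (@tuple_join T a b @^-1` A)%classic = iid D (a + b) A.
Proof.
move=> mA; apply: iid_pushforward => //; first exact: measurable_join.
move=> B mB; rewrite big_split_ord /=.
rewrite -(iid_rectangle D (fun i => mB (lshift b i))).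
rewrite -(iid_rectangle D (fun i => mB (rshift a i))).
rewrite -product_measure1E; last 2 first.
- by apply: measurable_rectangle; exists (fun i => B (lshift b i)).
- by apply: measurable_rectangle; exists (fun i => B (rshift a i)).
congr (_ _); apply/seteqP; split=> [p /= H|p /= [H1 H2] i].
  split=> i.
    by have := H (lshift b i); rewrite tnth_mktuple (unsplitK (inl i)).
  by have := H (rshift a i); rewrite tnth_mktuple (unsplitK (inr i)).
rewrite tnth_mktuple; case: (split_ordP i) => j ->; last exact: H2.
exact: H1.
Qed.

Lemma iid_join_le (a b : nat) (A : set ((a + b).-tuple T)) (c : R) :
  measurable A ->
  (forall x, \int[iid D b]_y (\1_A (tuple_join (x, y)) : R) <= c) ->
  (iid D (a + b) A <= c%:E)%E.
Proof.
move=> mA Ac; rewrite -iid_join //.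
have mJ : measurable (@tuple_join T a b @^-1` A)%classic.
  by rewrite -[X in measurable X]setTI; exact: measurable_join.
rewrite -expect_indic // lee_fin.
have bJ : bounded_measurable (\1_(@tuple_join T a b @^-1` A)%classic : _ -> R).
  apply: bounded_measurable01; first exact: measurable_indic.
  by move=> x; rewrite indicE; case: (_ \in _); rewrite ?ler01 lexx.
rewrite expect_fubini // -[leRHS](expect_cst (iid D a)).
apply: expect_le; first exact: bounded_measurable_expect.
  exact: bounded_measurable_cst.
exact: Ac.
Qed.

End iid_select_join.

(** * Hockey-stick divergence *)

Section hockey_stick.
Context (R : realType) (O : finType).

(** Pointwise, [P - expR (2 * e) * Q] is [(P - expR e * G) + expR e * (G - expR e * Q)], and
    positive parts are subadditive. *)
Lemma hockey_stick_trans (e : R) (P G Q : O -> R) :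
  hockey_stick (2 * e) P Q <= hockey_stick e P G + expR e * hockey_stick e G Q.
Proof.
rewrite /hockey_stick mulr_sumr -big_split ler_sum // => o _ /=.
have e_ge0 := expR_ge0 e.
have m1 : P o - expR e * G o <= Num.max (P o - expR e * G o) 0.
  by rewrite le_max lexx.
have m2 : G o - expR e * Q o <= Num.max (G o - expR e * Q o) 0.
  by rewrite le_max lexx.
have m3 : 0 <= Num.max (P o - expR e * G o) 0 by rewrite le_max lexx orbT.
have m4 : 0 <= Num.max (G o - expR e * Q o) 0 by rewrite le_max lexx orbT.
rewrite ge_max addr_ge0 ?mulr_ge0 // andbT.
apply: le_trans (lerD m1 (ler_wpM2l e_ge0 m2)).
have -> : 2 * e = e + e by ring.
by rewrite expRD le_eqVlt; apply/orP; left; apply/eqP; ring.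
Qed.

Lemma indist_common (e delta : R) (P Q G : O -> R) :
  indist e delta P G -> indist e delta Q G ->
  indist (2 * e) ((1 + expR e) * delta) P Q.
Proof.
move=> [PG GP] [QG GQ]; have e_ge0 := expR_ge0 e.
split; apply: (le_trans (hockey_stick_trans e _ G _));
  by rewrite mulrDl mul1r lerD // ler_wpM2l.
Qed.

Lemma indist_le (e delta delta' : R) (P Q : O -> R) : delta <= delta' ->
  indist e delta P Q -> indist e delta' P Q.
Proof. by move=> dd' [PQ QP]; split; apply: le_trans dd'. Qed.

Lemma measurable_indist (d : measure_display) (T : measurableType d)
    (F G : mechanism R T O) (e delta : R) :
  measurable [set x | indist e delta (F x) (G x)]%classic.
Proof.
have mH (F' G' : mechanism R T O) :
    measurable [set x | hockey_stick e (F' x) (G' x) <= delta]%classic.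
  rewrite -[X in measurable X]setTI.
  apply: (@measurable_fun_le _ _ _ _ (fun x => hockey_stick e (F' x) (G' x)) (fun=> delta)) => //.
  apply: measurable_sum => o; apply: measurable_maxr; last exact: measurable_cst.
  apply: measurable_funB; first exact: measurable_outprob.
  by apply: measurable_funM; [exact: measurable_cst | exact: measurable_outprob].
rewrite (_ : [set x | _]%classic =
  ([set x | hockey_stick e (F x) (G x) <= delta] `&`
   [set x | hockey_stick e (G x) (F x) <= delta])%classic) //.
exact: measurableI.
Qed.

End hockey_stick.

(** * Concentration of the output distribution around its mean *)

Section concentration.
Context (R : realType) (O : finType) (d : measure_display)
  (Z : measurableType d) (D : probability Z R).

Definition item_nbr (k m : nat) :
    k.-tuple (m.-tuple Z) -> k.-tuple (m.-tuple Z) -> Prop :=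
  @tuple_nbr _ (@tuple_nbr Z (fun _ _ => True) m) k.

Lemma indic01 (T : Type) (A : set T) x : 0 <= (\1_A x : R) <= 1.
Proof. by rewrite indicE; case: (_ \in _); rewrite ?ler01 lexx. Qed.

(** At step 0 the indicator of the bad event lies below the potential for every positive [v]: on the
    event the potential is at least 1, elsewhere it is nonnegative. Averaging over items and users
    costs [k * m] steps, and [v = 1] is taken at the end. *)
Lemma mean_concentration (k m l : nat) (F : mechanism R (k.-tuple (m.-tuple Z)) O)
    (e0 eps delta K B : R) :
  0 < delta -> 0 <= eps -> eps <= 8^-1 -> 0 < K -> 0 < B -> 0 <= e0 -> (0 < l)%N ->
  dp_on eps delta (@item_nbr k m) F ->
  \int[iid (iid D m) k]_x
    (\1_[set x | ~ indist e0 (delta + expR e0 * (B * K * delta)) (F x)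
                    (mean (iid (iid D m) k) F)]%classic x : R) <=
    potential l (mean (iid (iid D m) k) F) e0 delta (4 * eps) K B (k * m)
      (mean (iid (iid D m) k) F) (fun=> 1).
Proof.
move=> delta_gt0 eps_ge0 eps_le K_gt0 B_gt0 e0_ge0 l_gt0 dpF.
set P := iid (iid D m) k; set bad := [set x | _]%classic.
have M0_ge0 := mean_ge0 F P.
have eta_ge0 : 0 <= 4 * eps by rewrite mulr_ge0.
have mbad : measurable bad.
  (* A constant mechanism, which puts the mean in the form expected by [measurable_indist]. *)
  pose G : mechanism R (k.-tuple (m.-tuple Z)) O := @Mechanism R _ _ O
    (fun _ => mean P F) (fun _ => M0_ge0) (fun _ => mean_sum1 F P)
    (fun o => measurable_cst _).
  exact: measurableC (measurable_indist F G _ _).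
have av := averages_iid (k := k) (averages_iid (k := m) (averages_sample (O := O) D (l := l)
  (e0 := e0) M0_ge0 delta_gt0 eps_ge0 eps_le K_gt0 B_gt0)).
have mI : measurable_fun [set: k.-tuple (m.-tuple Z)]%classic (\1_bad : _ -> R).
  exact: measurable_indic.
have := av F (\1_bad) 0%N dpF mI (indic01 _).
rewrite muln1 add0n; apply=> // x v v_gt0.
have [Bx|Nx] := pselect (bad x).
  rewrite indicE mem_set // leNgt; apply/negP => pot; apply: Bx.
  apply: indist_of_potential_lt1 v_gt0 pot => //.
  by move=> o; exact: outprob_ge0.
by rewrite indicE memNset //; exact: potential_ge0.
Qed.

End concentration.

(** * Choice of parameters and size of the initial potential *)

Lemma expR1_le4 (R : realType) : expR 1 <= 4 :> R.
Proof.
have h : expR 2^-1 <= 2 :> R.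
  by apply: (le_trans (expR_le_quadratic (lexx _))); lra.
have -> : expR 1 = expR 2^-1 ^+ 2 :> R.
  by rewrite -expRM_natl mulfV // pnatr_eq0.
have -> : 4 = 2 ^+ 2 :> R by ring.
by rewrite lerXn2r ?nnegrE ?expR_ge0.
Qed.

Section parameters.
Context (R : realType) (O : finType).
Variables (p : O -> R) (eps delta kappa X : R) (r m : nat).
Hypotheses (p_sum1 : \sum_o p o = 1) (r_gt0 : (0 < r)%N) (m_gt0 : (0 < m)%N)
  (delta_gt0 : 0 < delta) (delta_le1 : delta <= 1)
  (X_ge3 : 3 <= X) (kappa_gt0 : 0 < kappa) (kappa_le : kappa <= 1000^-1)
  (kappaE : kappa ^+ 2 = eps ^+ 2 * (r * m)%:R * X).

(* The exponent is chosen so that [l * kappa] is about [X]; then the moments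
   have grown by a factor [exp (O X)] after [2 r m] steps. *)
Definition exponent : nat := (Num.truncn (X / kappa)).+1.

(** Over [s] steps the moments grow by at most [576 * X] in the exponent, and [580 = 576 + 4] leaves
    [expR (- (4 * X))]. For the loss, clipping adds at most [6 * l] while [expR 8] gains [8 * l];
    the surplus [2 * l >= 2000 * X] outweighs the same growth. *)
Lemma initial_potential_le (s : nat) : (s <= 2 * (r * m))%N ->
  potential exponent p (580 * kappa) delta (4 * eps) (2 * (r * m)%:R) (expR 8)
    s p (fun=> 1) <= expR (- (2 * X)) / (2 * delta).
Proof.
move=> s_le; set l := exponent; set q := X / kappa.
have rm_gt0 : 0 < (r * m)%:R :> R by rewrite ltr0n muln_gt0 r_gt0.
have qk : q * kappa = X by rewrite /q mulfVK // lt0r_neq0.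
have q_ge : 1000 * X <= q.
  have k1 : 0 <= 1 - 1000 * kappa by move: kappa_le; lra.
  have X0 : 0 <= X by move: X_ge3; lra.
  by rewrite /q ler_pdivlMr //; have := mulr_ge0 X0 k1; lra.
have q_ge0 : 0 <= q by move: X_ge3; lra.
have /andP[l1 l2] := truncn_itv q_ge0.
have ql : q <= l%:R by rewrite ltW.
have l_le : l.+1%:R <= 3 * q.
  by rewrite /l /exponent -!natr1 -/q; move: X_ge3; lra.
have sR : s%:R <= 2 * (r * m)%:R :> R by rewrite -natrM ler_nat.
have q2 : q ^+ 2 * eps ^+ 2 * (r * m)%:R = X.
  have : q ^+ 2 * kappa ^+ 2 = X ^+ 2 by rewrite -exprMn qk.
  rewrite kappaE => qE; have X_neq0 : X != 0 by rewrite lt0r_neq0 //; move: X_ge3; lra.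
  by apply: (mulIf X_neq0); rewrite -expr2 -qE; ring.
have s_rate : s%:R * rate l (4 * eps) <= 576 * X.
  apply: (@le_trans _ _ (2 * (r * m)%:R * (2 * ((3 * q) ^+ 2 * (4 * eps) ^+ 2)))).
    rewrite ler_pM // /rate; first by rewrite mulr_ge0 // mulr_ge0 // sqr_ge0.
    rewrite ler_pM2l // ler_wpM2r ?sqr_ge0 // ler_sqr ?nnegrE //.
    by rewrite mulr_ge0.
  by rewrite -q2 le_eqVlt; apply/orP; left; apply/eqP; ring.
have mom : moments l p (fun=> 1) = 2.
  by rewrite /moments !expr1n invr1 expr1n -!mulr_suml p_sum1; ring.
have loss0 : loss p p (fun=> 1) = 0.
  by rewrite /loss big1 // => o _; rewrite mulr1 subrr normr0.
have K_gt0 : 0 < 2 * (r * m)%:R :> R by rewrite mulr_gt0.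
rewrite /potential mom loss0 add0r.
(* Nothing is lost at the start, so only the offset remains. *)
have -> : 2 * (r * m)%:R * delta / (expR 8 * (2 * (r * m)%:R) * delta) = expR (- 8).
  by rewrite expRN; field; rewrite !lt0r_neq0 ?expR_gt0 ?ltr0n.
have lk : X <= l%:R * kappa by rewrite -qk ler_wpM2r // ltW.
have T1 : expR (s%:R * rate l (4 * eps)) * (expR (- (l%:R * (580 * kappa))) / delta) * 2
    <= expR (- (4 * X)) / delta * 2.
  rewrite ler_pM2r // mulrA ler_pM2r ?invr_gt0 // -expRD ler_expR.
  by move: s_rate lk; lra.
have T2 : expR (s%:R * loss_rate l (4 * eps) (2 * (r * m)%:R)) * expR (- 8) ^+ l
    <= expR (- (4 * X)) / delta.
  apply: (@le_trans _ _ (expR (- (4 * X)))); last first.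
    by rewrite ler_pdivlMr // ler_piMr ?expR_ge0.
  rewrite -expRM_natl -expRD ler_expR /loss_rate mulrDr.
  have : s%:R * (l%:R * (6 / (2 * (r * m)%:R))) <= 6 * l%:R :> R.
    have perm (a b c : R) : a * (b * (6 * c)) = 6 * b * (a * c) by ring.
    rewrite perm.
    by rewrite ler_piMr ?mulr_ge0 // ler_pdivrMr // mul1r.
  by move: s_rate ql q_ge X_ge3; lra.
apply: (le_trans (lerD T1 T2)).
(* Three copies of [expR (- (4 * X))] then fit under half of [expR (- (2 * X))]. *)
have e6 : 6 <= expR (2 * X).
  by apply: le_trans (expR_ge1Dx _); move: X_ge3; lra.
have -> : expR (- (4 * X)) = expR (- (2 * X)) * expR (- (2 * X)).
  by rewrite -expRD; congr expR; ring.
have E0 := expR_gt0 (- (2 * X)).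
have E1 : expR (- (2 * X)) <= 6^-1.
  by rewrite expRN lef_pV2 ?posrE ?expR_gt0.
have -> : expR (- (2 * X)) / (2 * delta) = expR (- (2 * X)) * (6^-1 * 3) / delta.
  by field; rewrite lt0r_neq0.
set E := expR _ in E0 E1 *.
have -> : E * E / delta * 2 + E * E / delta = E * (E * 3) / delta.
  by field; rewrite lt0r_neq0.
by rewrite ler_pM2r ?invr_gt0 // ler_pM2l // ler_pM2r.
Qed.

End parameters.

(** * A common reference for two overlapping selections *)

Section common_reference.
Context (R : realType) (O : finType) (d : measure_display)
  (Z : measurableType d) (D : probability Z R).
Variables (m : nat) (e0 dlt eps delta gamma : R).

Definition concentrates (b : nat) : Prop :=
  forall F : mechanism R (b.-tuple (m.-tuple Z)) O,
    dp_on eps delta (@item_nbr _ Z b m) F ->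
    \int[iid (iid D m) b]_x
      (\1_[set x | ~ indist e0 dlt (F x) (mean (iid (iid D m) b) F)]%classic x : R)
    <= gamma.

(** Given the data in the slots where [f] and [f'] agree, averaging over the other slots yields a
    mechanism of the shared data alone, hence one reference for both selections. Concentration is
    applied only on the differing slots. *)
Lemma indist_common_reference (n N : nat)
    (A : mechanism R (N.-tuple (m.-tuple Z)) O) (f f' : 'I_N -> 'I_n) :
  injective f -> injective f' -> item_level_dp A eps delta ->
  concentrates #|[set k | f k != f' k]| ->
  exists G : mechanism R (n.-tuple (m.-tuple Z)) O,
    (iid (iid D m) n [set x | ~ indist e0 dlt (A (tuple_select f x)) (G x)]%classic
      <= gamma%:E)%E /\
    (iid (iid D m) n [set x | ~ indist e0 dlt (A (tuple_select f' x)) (G x)]%classic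
      <= gamma%:E)%E.
Proof.
move=> injf injf' dpA; set V := [set k | f k != f' k].
set a := #|~: V|; set b := #|V| => conc.
(* Agreeing slots come first, differing ones last, so that a joined tuple separates into shared and
   fresh data. *)
pose tau (i : 'I_(a + b)) : 'I_N :=
  match fintype.split i with inl j => enum_val j | inr j => enum_val j end.
have tauL j : tau (lshift b j) = enum_val j by rewrite /tau (unsplitK (inl j)).
have tauR j : tau (rshift a j) = enum_val j by rewrite /tau (unsplitK (inr j)).
have tau_inj : injective tau.
  move=> i i'; case: (split_ordP i) => j ->; case: (split_ordP i') => j' ->;
    rewrite ?tauL ?tauR.
  - by move/enum_val_inj ->.
  - by move=> E; have := enum_valP j; rewrite E inE enum_valP.
  - by move=> E; have := enum_valP j'; rewrite -E inE enum_valP.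
  - by move/enum_val_inj ->.
have [tau' tauK tau'K] : bijective tau.
  by apply: inj_card_bij => //; rewrite !card_ord addnC cardsC card_ord.
pose A' := comp_mechanism A (@measurable_select _ (m.-tuple Z) _ _ tau').
pose H := comp_mechanism A' (@measurable_join _ (m.-tuple Z) a b).
pose G0 := partial_mean (iid (iid D m) b) H.
pose G1 := comp_mechanism G0 (@measurable_select _ (m.-tuple Z) _ _ (lshift b)).
pose E := [set u | ~ indist e0 dlt (A' u) (G1 u)]%classic.
have mE : measurable E by exact: measurableC (measurable_indist A' G1 _ _).
have PE : (iid (iid D m) (a + b) E <= gamma%:E)%E.
  apply: iid_join_le => // c; have := conc (section_mechanism H c).
  have selc y : tuple_select (lshift b) (tuple_join (c, y)) = c.
    by apply: eq_from_tnth => j; rewrite !tnth_mktuple (unsplitK (inl j)).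
  rewrite (_ : (fun y => \1_E (tuple_join (c, y))) =
    \1_[set x | ~ indist e0 dlt (section_mechanism H c x)
      (mean (iid (iid D m) b) (section_mechanism H c))]%classic); last first.
    apply/funext => y; rewrite !indicE; congr (nat_of_bool _)%:R.
    by apply/idP/idP; rewrite !inE /E /= selc.
  (* An item changed in the fresh part is one item of the full input, in slot [tau (rshift a i)]. *)
  apply=> y y' [i [[j [_ Nj]] Ni]] S; apply: dpA.
  exists (tau (rshift a i)), j => i' j' Nij; rewrite !tnth_mktuple.
  case: (split_ordP (tau' i')) => k E' //=.
  have [ki|/eqP ki] := eqVneq k i; last by rewrite Ni.
  rewrite ki Nj // => jj; apply: Nij.
  by rewrite jj -ki -E' tau'K.
(* For any injective [g], selecting along [g \o tau] gives the product law, so the bound on [E]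
   transfers to [f] and [f'] alike. *)
have key (g : 'I_N -> 'I_n) : injective g -> (iid (iid D m) n [set x |
    ~ indist e0 dlt (A (tuple_select g x))
        (G0 (tuple_select (fun j => g (tau (lshift b j))) x))]%classic
    <= gamma%:E)%E.
  move=> injg; apply: le_trans PE.
  rewrite -(iid_select (iid D m) (inj_comp injg tau_inj) mE).
  rewrite (_ : [set x | _]%classic = (tuple_select (g \o tau) @^-1` E)%classic) //.
  apply/funext => x /=; rewrite /E /=.
  have -> : tuple_select tau' (tuple_select (g \o tau) x) = tuple_select g x.
    by apply: eq_from_tnth => k; rewrite !tnth_mktuple /= tau'K.
  rewrite (_ : tuple_select (lshift b) (tuple_select (g \o tau) x) =
    tuple_select (fun j => g (tau (lshift b j))) x) //.
  by apply: eq_from_tnth => k; rewrite !tnth_mktuple.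
exists (comp_mechanism G0 (@measurable_select _ (m.-tuple Z) _ _
  (fun j => f (tau (lshift b j))))); split; first exact: key.
(* The reference reads agreeing slots only. *)
have -> : (fun j => f (tau (lshift b j))) = (fun j => f' (tau (lshift b j))).
  apply/funext => j; rewrite tauL; have := enum_valP j.
  by rewrite !inE negbK => /eqP.
exact: key.
Qed.

End common_reference.

(** * Local-deletion DP: measurability, listings and the union bound *)

Section local_deletion.
Context (R : realType) (O : finType) (d : measure_display)
  (Z : measurableType d).

Lemma measurable_local_deletion_dp (n r m : nat) (L : listing n r)
    (A : mechanism R ((n - r).-tuple (m.-tuple Z)) O) (e delta : R) :
  measurable [set x | local_deletion_dp L A e delta x]%classic.
Proof.
pose M (S : {set 'I_n}) :=
  comp_mechanism A (@measurable_select _ (m.-tuple Z) _ _ (L S)).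
(* Pairs of the wrong cardinality impose nothing, so the intersection runs over a whole finite
   type. *)
pose good (SS : {set 'I_n} * {set 'I_n}) : set (n.-tuple (m.-tuple Z)) :=
  if (#|SS.1| == r) && (#|SS.2| == r) then
    [set x | indist e delta (M SS.1 x) (M SS.2 x)]%classic else setT.
rewrite (_ : [set x | _]%classic =
  (\bigcap_(SS in [set: {set 'I_n} * {set 'I_n}]) good SS)%classic).
  apply: fin_bigcap_measurable => [|SS _]; first exact: finite_finset.
  rewrite /good; case: ifP => _; last exact: measurableT.
  exact: measurable_indist.
apply/seteqP; split=> [x H [S S'] _|x H S S' cS cS'].
  by rewrite /good /=; case: ifP => // /andP[/eqP cS /eqP cS']; exact: H.
by have := H (S, S') I; rewrite /good /= cS cS' !eqxx.
Qed.

(** Both listings enumerate the complement of [S]: injectivity and a cardinality count make [L' S]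
    onto it. *)
Lemma survivors_perm (n r : nat) (L L' : listing n r) (S : {set 'I_n}) :
  lists_survivors L -> lists_survivors L' -> #|S| = r ->
  exists s : 'S_(n - r), forall k, L S k = L' S (s k).
Proof.
move=> LP LP' cS; have [injL LS] := LP S cS; have [injL' LS'] := LP' S cS.
have codL' : L' S @: finset.setT = ~: S.
  apply/eqP; rewrite eqEcard; apply/andP; split.
    by apply/fintype.subsetP => i /imsetP[k _ ->]; rewrite inE.
  by rewrite card_imset // cardsT card_ord cardsCs finset.setCK card_ord cS.
have ex k : exists k', L S k == L' S k'.
  have : L S k \in ~: S by rewrite inE.
  by rewrite -codL' => /imsetP[k' _ ->]; exists k'.
pose f k := xchoose (ex k).
have fE k : L S k = L' S (f k) by apply/eqP; exact: (xchooseP (ex k)).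
have f_inj : injective f by move=> k k' E; apply: injL; rewrite !fE E.
by exists (perm f_inj) => k; rewrite permE.
Qed.

Lemma symmetric_listing (n r m : nat) (L L' : listing n r)
    (A : mechanism R ((n - r).-tuple (m.-tuple Z)) O) (e delta : R) x :
  user_symmetric A -> lists_survivors L -> lists_survivors L' ->
  local_deletion_dp L A e delta x -> local_deletion_dp L' A e delta x.
Proof.
move=> symA LP LP' H.
have AE (S : {set 'I_n}) : #|S| = r -> A (remove_users L' x S) = A (remove_users L x S).
  move=> cS; have [s sE] := survivors_perm LP' LP cS.
  apply/funext => o; rewrite -[RHS](symA s); congr (A _ o).
  by apply: eq_from_tnth => k; rewrite !tnth_mktuple sE.
by move=> S S' cS cS'; rewrite !AE //; exact: H.
Qed.

Lemma bin_le_expn (n r : nat) : ('C(n, r) <= n ^ r)%N.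
Proof.
apply: (@leq_trans (n ^_ r)); first by rewrite -bin_ffact leq_pmulr ?fact_gt0.
elim: r => [|r IH]; first by rewrite ffactn0 expn0.
by rewrite ffactnSr expnSr leq_mul ?leq_subr.
Qed.

(** In a failing pair one of the two outputs is far from the common reference, so a pair fails with
    probability at most [gamma * 2]. The number of pairs is the square of ['C(n, r) <= n ^ r]. *)
Lemma local_deletion_union_bound (D : probability Z R) (n r m : nat)
    (L : listing n r) (A : mechanism R ((n - r).-tuple (m.-tuple Z)) O)
    (e0 dlt e dlt' gamma beta : R) :
  0 <= gamma ->
  (forall P Q G : O -> R, indist e0 dlt P G -> indist e0 dlt Q G ->
    indist e dlt' P Q) ->
  (forall S S' : {set 'I_n}, #|S| = r -> #|S'| = r ->
    exists G : mechanism R (n.-tuple (m.-tuple Z)) O,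
    (iid (iid D m) n [set x | ~ indist e0 dlt (A (remove_users L x S)) (G x)]%classic
      <= gamma%:E)%E /\
    (iid (iid D m) n [set x | ~ indist e0 dlt (A (remove_users L x S')) (G x)]%classic
      <= gamma%:E)%E) ->
  gamma * (2 * (n ^ (2 * r))%:R) <= beta ->
  ((1 - beta)%:E <= iid (iid D m) n
    [set x | local_deletion_dp L A e dlt' x]%classic)%E.
Proof.
move=> gamma_ge0 tri pairs le_beta; set P := iid (iid D m) n.
set good := [set x | _]%classic.
have mgood : measurable good by exact: measurable_local_deletion_dp.
pose M (S : {set 'I_n}) :=
  comp_mechanism A (@measurable_select _ (m.-tuple Z) _ _ (L S)).
have bI (B : set (n.-tuple (m.-tuple Z))) : measurable B ->
    bounded_measurable (\1_B : _ -> R).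
  move=> mB; apply: bounded_measurable01; first exact: measurable_indic.
  exact: indic01.
have i0 (B : set (n.-tuple (m.-tuple Z))) x : 0 <= (\1_B x : R).
  by have /andP[] := @indic01 R _ B x.
pose bad (S S' : {set 'I_n}) := [set x | ~ indist e dlt' (M S x) (M S' x)]%classic.
have mbad S S' : measurable (bad S S').
  exact: measurableC (measurable_indist (M S) (M S') _ _).
have Pbad (S S' : {set 'I_n}) : #|S| = r -> #|S'| = r ->
    \int[P]_x (\1_(bad S S') x : R) <= gamma * 2.
  move=> cS cS'; have [G [GS GS']] := pairs S S' cS cS'.
  pose far (U : {set 'I_n}) := [set x | ~ indist e0 dlt (M U x) (G x)]%classic.
  have mfar U : measurable (far U).
    exact: measurableC (measurable_indist (M U) G _ _).
  rewrite -lee_fin expect_indic //.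
  apply: (@le_trans _ _ (P (far S `|` far S')%classic)).
    apply: le_measure; rewrite ?inE //; first exact: measurableU.
    move=> x bx; have [nS|/contrapT iS] := pselect (far S x); first by left.
    by right => iS'; apply: bx; exact: (tri _ _ (G x)).
  apply: (le_trans (measureU2 _ _ _)) => //.
  by rewrite mulr2n mulrDr mulr1 EFinD leeD.
have bad_le : \int[P]_x (\1_(~` good)%classic x : R) <=
    \int[P]_x (\sum_(S : {set 'I_n} | #|S| == r)
               \sum_(S' : {set 'I_n} | #|S'| == r) (\1_(bad S S') x : R)).
  apply: expect_le.
  - exact/bI/measurableC.
  - by do 2 apply: bounded_measurable_sum => ?; exact: bI.
  - move=> x; rewrite [leLHS]indicE.
    have [gx|ngx] := pselect (good x).
      rewrite memNset /=; last by apply.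
      by do 2 apply: sumr_ge0 => ? _; exact: i0.
    have [[S S'] /= [/eqP cS /eqP cS' bSS']] :
        exists SS : {set 'I_n} * {set 'I_n}, [/\ #|SS.1| = r, #|SS.2| = r & bad SS.1 SS.2 x].
      apply: contrapT => H; apply: ngx => S S' cS cS'.
      by apply: contrapT => B; apply: H; exists (S, S').
    rewrite mem_set // (bigD1 S) //= (bigD1 S') //= indicE mem_set //.
    rewrite -addrA lerDl addr_ge0 //.
      by apply: sumr_ge0 => ? _; exact: i0.
    by do 2 apply: sumr_ge0 => ? _; exact: i0.
have : \int[P]_x (\1_(~` good)%classic x : R) <= beta.
  apply: (le_trans bad_le); apply: le_trans le_beta.
  rewrite expect_sum; last by move=> S; apply: bounded_measurable_sum => ?; exact: bI.
  apply: (@le_trans _ _ (\sum_(S : {set 'I_n} | #|S| == r)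
                         \sum_(S' : {set 'I_n} | #|S'| == r) (gamma * 2))).
    apply: ler_sum => S /eqP cS; rewrite expect_sum; last by move=> S'; exact: bI.
    by apply: ler_sum => S' /eqP cS'; exact: Pbad.
  rewrite !sumr_const -mulrnA -[leLHS]mulr_natr -mulrA ler_wpM2l // ler_pM2l // ler_nat.
  have -> : #|[pred S : {set 'I_n} | #|S| == r]| = 'C(n, r).
    by rewrite -[in RHS](card_ord n) -card_draws cardsE.
  by rewrite mul2n -addnn expnD leq_mul ?bin_le_expn.
rewrite -lee_fin expect_indic; last exact: measurableC.
rewrite probability_setC // -(fineK (fin_num_measure P _ mgood)).
by rewrite -EFinB !lee_fin; lra.
Qed.

End local_deletion.

(** * Constants and conclusion *)

Lemma ln_ge3 (R : realType) (x : R) : 1000 <= x -> 3 <= ln x.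
Proof.
move=> x_ge; have x_gt0 : 0 < x by lra.
rewrite -ler_expR lnK ?posrE //; apply: le_trans x_ge.
have -> : expR 3 = expR 1 ^+ 3 :> R by rewrite -expRM_natl mulr1.
apply: (@le_trans _ _ (4 ^+ 3)); last by lra.
by rewrite lerXn2r ?nnegrE ?expR_ge0 // expR1_le4.
Qed.

Theorem theorem3p8 (R : realType) :
  exists c C1 C2 : R, [/\ 0 < c, 0 < C1 & 0 < C2] /\
  forall (d : measure_display) (Z : measurableType d) (O : finType)
    (n r m : nat) (beta eps' delta' : R)
    (A : mechanism R ((n - r).-tuple (m.-tuple Z)) O),
  let kappa : R :=
    eps' * r%:R * Num.sqrt (m%:R * ln (n%:R / (beta * delta'))) in
  (r <= n)%N ->
  0 < beta ->
  item_level_dp A eps' delta' ->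
  0 < eps' <= c ->
  0 < delta' <= c ->
  0 < kappa <= c ->
  forall D : probability Z R,
  let good (L : listing n r) : set (n.-tuple (m.-tuple Z)) :=
    [set x | local_deletion_dp L A
               (C1 * kappa) (C2 * (r * m)%:R * delta') x]%classic in
  ((1 - beta)%:E <= iid (iid D m) n (good (@in_place_listing n r)))%E /\
  (user_symmetric A ->
    (1 - beta)%:E <= iid (iid D m) n (good (@increasing_listing n r)))%E.
Proof.
(* [1160 = 2 * 580] comes from the triangle inequality through the reference. In [45 = 5 * 9], 5
   bounds [1 + expR (580 * kappa)], and 9 comes from bounding [dlt]. *)
exists 1000^-1, 1160, (45 * expR 8); split.
  by split; [lra | lra | rewrite mulr_gt0 ?expR_gt0 ?ltr0n].
move=> d Z O n r m beta eps delta A kappa rn beta_gt0 dpA.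
move=> /andP[eps_gt0 eps_le] /andP[delta_gt0 delta_le] /andP[kappa_gt0 kappa_le].
move=> D good.
(* For [beta >= 1] the claim is trivial; [beta < 1] keeps [beta * delta] small, which makes the
   logarithm at least 3. *)
have [beta_ge1|beta_lt1] := leP 1 beta.
  have le0 B : ((1 - beta)%:E <= iid (iid D m) n B)%E.
    by apply: (@le_trans _ _ 0%E); rewrite ?measure_ge0 // lee_fin; lra.
  by split.
suff in_place : ((1 - beta)%:E <= iid (iid D m) n (good (@in_place_listing n r)))%E.
  split=> // symA; apply: (le_trans in_place); apply: le_measure;
    rewrite ?inE; [exact: measurable_local_deletion_dp ..|].
  move=> x; apply: symmetric_listing => //; first exact: in_place_listingP.
  exact: increasing_listingP.
(* Positivity of [kappa] excludes [r = 0] and [m = 0]. *)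
have r_gt0 : (0 < r)%N.
  by rewrite lt0n; apply/negP => /eqP r0; move: kappa_gt0; rewrite /kappa r0 mulr0 mul0r ltxx.
have m_gt0 : (0 < m)%N.
  rewrite lt0n; apply/negP => /eqP m0; move: kappa_gt0.
  by rewrite /kappa m0 mul0r sqrtr0 mulr0 ltxx.
have n_ge1 : 1 <= n%:R :> R by rewrite ler1n (leq_trans r_gt0).
have bd_gt0 : 0 < beta * delta by rewrite mulr_gt0.
have bd_le : beta * delta <= 1000^-1.
  by apply: le_trans delta_le; rewrite ler_piMl // ltW.
pose Lam : R := ln (n%:R / (beta * delta)).
have Lam_ge3 : 3 <= Lam.
  by apply: ln_ge3; rewrite ler_pdivlMr //; lra.
(* The factor [r] lets [expR (- (2 * X))] pay for [n ^ (2 * r)] pairs. *)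
pose X : R := r%:R * Lam.
have X_ge3 : 3 <= X.
  apply: (le_trans Lam_ge3); rewrite ler_peMl ?ler1n //; lra.
have kappaE : kappa ^+ 2 = eps ^+ 2 * (r * m)%:R * X.
  rewrite /kappa exprMn sqr_sqrtr; first by rewrite /X natrM -/Lam; ring.
  by rewrite mulr_ge0 // -/Lam; lra.
pose gamma : R := expR (- (2 * X)) / (2 * delta).
have rm_ge1 : 1 <= (r * m)%:R :> R by rewrite ler1n muln_gt0 r_gt0.
have B_ge1 : 1 <= expR 8 :> R by rewrite -expR0 ler_expR.
pose dlt : R := delta + expR (580 * kappa) * (expR 8 * (2 * (r * m)%:R) * delta).
have e4 : expR (580 * kappa) <= 4.
  by apply: le_trans (@expR1_le4 R); rewrite ler_expR; lra.
apply: (@local_deletion_union_bound _ _ _ _ _ _ _ _ _ _ (580 * kappa) dlt _ _ gamma).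
- by rewrite divr_ge0 ?expR_ge0 // mulr_ge0 // ltW.
- move=> P Q G PG QG; have := indist_common PG QG.
  rewrite (_ : 2 * (580 * kappa) = 1160 * kappa); last by ring.
  apply: indist_le.
  have Bd : 0 <= expR 8 * (2 * (r * m)%:R) * delta.
    by rewrite !mulr_ge0 ?expR_ge0 // ltW.
  have Brm : delta <= expR 8 * (r * m)%:R * delta.
    by rewrite ler_peMl ?(ltW delta_gt0) // mulr_ege1.
  have dlt_le : dlt <= 9 * (expR 8 * (r * m)%:R * delta).
    by have := ler_wpM2r Bd e4; rewrite /dlt; lra.
  apply: (@le_trans _ _ (5 * dlt)); last by lra.
  rewrite ler_wpM2r //; last by lra.
  exact: addr_ge0 (ltW delta_gt0) (mulr_ge0 (expR_ge0 _) Bd).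
- move=> S S' cS cS'; apply: indist_common_reference dpA _.
  + by have [] := in_place_listingP cS.
  + by have [] := in_place_listingP cS'.
  set b := #|_|; have b_le : (b <= 2 * r)%N.
    rewrite /b cardsE; exact: in_place_listing_stable.
  move=> F dpF.
  have delta_le1 : delta <= 1 by lra.
  have s_le : (b * m <= 2 * (r * m))%N by rewrite mulnA leq_mul2r b_le orbT.
  apply: le_trans (initial_potential_le (mean_sum1 F _) r_gt0 m_gt0
    delta_gt0 delta_le1 X_ge3 kappa_gt0 kappa_le kappaE s_le).
  have eps_le8 : eps <= 8^-1 by lra.
  have e0_ge0 : 0 <= 580 * kappa by lra.
  have K_gt0 : 0 < 2 * (r * m)%:R :> R by lra.
  exact: (mean_concentration D delta_gt0 (ltW eps_gt0) eps_le8 K_gt0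
    (expR_gt0 8) e0_ge0 (ltn0Sn _) dpF).
(* The powers of [n] cancel and leave [(beta * delta) ^ (2 * r) / delta]. One factor [beta * delta]
   gives [beta]; the others are at most 1. *)
- have k_gt0 : (0 < 2 * r)%N by rewrite muln_gt0.
  have E : expR (- (2 * X)) = (beta * delta / n%:R) ^+ (2 * r).
    rewrite (_ : - (2 * X) = (2 * r)%:R * - Lam); last by rewrite /X natrM; ring.
    rewrite expRM_natl expRN lnK ?invf_div // posrE divr_gt0 //; lra.
  rewrite /gamma E expr_div_n natrX -(prednK k_gt0); move: (2 * r).-1 => k.
  have nk : n%:R ^+ k.+1 != 0 :> R by rewrite expf_neq0 // lt0r_neq0 //; lra.
  have -> : (beta * delta) ^+ k.+1 / n%:R ^+ k.+1 / (2 * delta) * (2 * n%:R ^+ k.+1)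
      = (beta * delta) ^+ k.+1 / delta by field; rewrite nk lt0r_neq0.
  rewrite ler_pdivrMr // exprS ler_piMr ?(ltW bd_gt0) // exprn_ile1 ?(ltW bd_gt0) //.
  by lra.
Qed.
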